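(* Assume the uniform PL$^\circ$ condition and the regularity conditions. Then all the manifolds $\mathcal S(\theta)$, $\theta\in\Theta$, have one common dimension: there is an integer $\mathtt k$ such that $\dim\mathcal S(\theta)=\mathtt k$ for every $\theta\in\Theta$.
   Context: Setting: $m\ge1$, $d\ge2$; $\Theta\subset\mathbb R^m$ is a nonempty compact convex set; $f,g:\Theta\times\mathbb R^d\to\mathbb R$; $\|\cdot\|$ is the Euclidean norm (or induced operator norm); $\partial_\theta,\partial_x$ are the gradients in the first/second argument and $\partial_x^2$ is the Hessian in $x$. $\mathcal S(\theta):=\operatorname{argmin}_{x\in\mathbb R^d}g(\theta,x)$. PL$^\circ$: a $\mathcal C^1$ function $h:\mathbb R^d\to\mathbb R$ with set of local minima $\mathcal M$ is locally PL with constant $\mu>0$ if every connected component $\mathcal M'$ of $\mathcal M$ has an open neighborhood $\mathcal N(\mathcal M')\supset\mathcal M'$ with $h(x)-\min_{x'\in\mathcal N(\mathcal M')}h(x')\le(2\mu)^{-1}\|\nabla h(x)\|^2$ for all $x\in\mathcal N(\mathcal M')$. $h$ satisfies the PL$^\circ$ condition with constant $\mu$ if (a) $h\in\mathcal C^2$, $h$ is locally PL with constant $\mu$, and $h$ is $\mathcal C^4$ on every $\mathcal N(\mathcal M')$; (b) every $x\notin\bigcup_{\mathcal M'}\mathcal N(\mathcal M')$ with $\nabla h(x)=0$ satisfies $\nabla^2h(x)\prec0$; (c) $\mathcal M$ is contained in a compact set. Uniform PL$^\circ$ condition: there is one $\mu>0$ such that for every $\theta\in\Theta$, $g(\theta,\cdot)$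 satisfies the PL$^\circ$ condition with constant $\mu$ (the neighborhoods may depend on $\theta$). Regularity conditions (constants independent of $\theta$): (i) $f$ is $\mathcal C^1$ and $L_{f,1}$-Lipschitz with respect to $(\theta,x)$, and $|f(\theta,x)|\le C_f\|x\|^{\mathsf n_f}+D_f$ for all $x$, with $C_f,D_f\ge0$ and an integer $\mathsf n_f\ge1$. (ii) $g$ has a $\mathcal C^2$ extension to an open neighborhood of $\Theta\times\mathbb R^d$; $\|\partial_xg(\theta,x)-\partial_xg(\theta,x')\|\le L_{g,xx}\|x-x'\|$ and $\|\partial_xg(\theta,x)-\partial_xg(\theta',x)\|\le L_{g,\theta x}\|\theta-\theta'\|$ for all $\theta,\theta'\in\Theta$, $x,x'\in\mathbb R^d$; and $\|\partial_\theta g(\theta,x)\|\le C_g\|x\|^{\mathsf n_g}+D_g$ with $C_g,D_g\ge0$, integer $\mathsf n_g\ge1$. (iii) $\partial_x^2g$ is continuous in $(\theta,x)$. (iv) There are $r_3>0$, $L_{g,3}<\infty$ with $\|\partial_x^2g(\theta,x)-\partial_x^2g(\theta,y)\|\le L_{g,3}\|x-y\|$ for all $\theta\in\Theta$ and all $x,y$ with $\max\{\operatorname{dist}(x,\mathcal S(\theta)),\operatorname{dist}(y,\mathcal S(\theta))\}\le r_3$. (v) There are $\mathsf D_{\mathsf{eb}},\nu_{\mathsf{eb}}>0$ with $\|\partial_xg(\theta,x)\|\ge\nu_{\mathsf{eb}}\operatorname{dist}(x,\mathcal S(\theta))$ for all $\theta\in\Theta$, $\|x\|\ge\mathsf D_{\mathsf{eb}}$.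 Background fact (known from earlier work): under these conditions each $\mathcal S(\theta)$ is a nonempty compact connected $\mathcal C^2$ embedded submanifold of $\mathbb R^d$ without boundary, equal to the set of all local minima of $g(\theta,\cdot)$. *)

(* Defs.v *)
From HB Require Import structures.
From mathcomp Require Import all_boot all_order all_algebra.
From mathcomp Require Import all_classical all_reals all_analysis.
Set Implicit Arguments.
Unset Strict Implicit.
Unset Printing Implicit Defensive.
Import Order.TTheory GRing.Theory Num.Theory.
Import numFieldNormedType.Exports.
Local Open Scope classical_set_scope.
Local Open Scope ring_scope.

(* R^n is 'rV[R]_n. The library norm `|x| on row vectors is the sup norm; it is
   used only for the topology and for differentiability, which do not depend on
   the choice of norm. All quantitative estimates use the Euclidean norm. *)

Definition enorm (R : realType) (n : nat) (u : 'rV[R]_n) : R :=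
  Num.sqrt (\sum_(i < n) u ord0 i ^+ 2).

Definition opnorm (R : realType) (n : nat) (A : 'M[R]_n) : R :=
  sup [set enorm (v *m A) | v in [set v : 'rV[R]_n | enorm v <= 1]].

(* Extended-real valued, so that the distance to the empty set is +oo. *)
Definition dist (R : realType) (n : nat) (x : 'rV[R]_n) (A : set 'rV[R]_n)
    : \bar R :=
  ereal_inf [set (enorm (x - y))%:E | y in A].

(* In finite dimension, F is C^(k+1) on an open set U iff it is differentiable
   on U and x |-> 'd F x v is C^k on U for every vector v. *)
Fixpoint Ck (R : realType) (V W : normedModType R) (k : nat) (U : set V)
    (F : V -> W) : Prop :=
  if k is k'.+1 then
    (forall x, U x -> differentiable F x) /\ (forall v : V, Ck k' U ('D_v F))
  else forall x, U x -> {for x, continuous F}.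

Definition gradient (R : realType) (n : nat) (h : 'rV[R]_n -> R)
    (x : 'rV[R]_n) : 'rV[R]_n :=
  \row_(i < n) 'D_(delta_mx ord0 i) h x.

Definition hessian (R : realType) (n : nat) (h : 'rV[R]_n -> R)
    (x : 'rV[R]_n) : 'M[R]_n :=
  \matrix_(i < n, j < n) 'D_(delta_mx ord0 i) ('D_(delta_mx ord0 j) h) x.

Definition negative_definite (R : realType) (n : nat) (A : 'M[R]_n) : Prop :=
  forall v : 'rV[R]_n, v != 0 -> (v *m A *m v^T) ord0 ord0 < 0.

Definition argmin (R : realType) (T : Type) (A : set T) (h : T -> R) : set T :=
  [set x | A x /\ forall y, A y -> h x <= h y].

Definition local_minima (R : realType) (n : nat) (h : 'rV[R]_n -> R)
    : set 'rV[R]_n :=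
  [set x | \forall y \near x, h x <= h y].

Definition components (T : topologicalType) (A : set T) : set (set T) :=
  [set connected_component A x | x in A].

(* S is a k-dimensional embedded C^p submanifold of R^d (without boundary),
   given by local defining functions: near each of its points, S is the zero
   set of a C^p map to R^(d-k) whose differential at that point has rank d-k.
   'J F x is the library's Jacobian matrix acting on row vectors. *)
Definition embedded_submanifold (R : realType) (d p k : nat)
    (S : set 'rV[R]_d) : Prop :=
  (k <= d)%N /\
  forall x, S x ->
    exists (U : set 'rV[R]_d) (F : 'rV[R]_d -> 'rV[R]_(d - k)),
      [/\ open U, U x, Ck p U F,
          (forall y, U y -> (S y <-> F y = 0)) &
          \rank ('J F x) = (d - k)%N].

(* N assigns to each connected component M' of the set of local minima of h its
   neighbourhood N(M'). *)
Definition locally_PL (R : realType) (d : nat) (mu : R) (h : 'rV[R]_d -> R)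
    (N : set 'rV[R]_d -> set 'rV[R]_d) : Prop :=
  forall M', components (local_minima h) M' ->
    [/\ open (N M'), M' `<=` N M' &
        exists2 x0, argmin (N M') h x0 &
          forall x, N M' x ->
            h x - h x0 <= (2 * mu)^-1 * enorm (gradient h x) ^+ 2].

Definition PLcirc (R : realType) (d : nat) (mu : R) (h : 'rV[R]_d -> R)
    : Prop :=
  let M := local_minima h in
  Ck 2 setT h /\
  (exists N : set 'rV[R]_d -> set 'rV[R]_d,
    [/\ locally_PL mu h N,
        (forall M', components M M' -> Ck 4 (N M') h) &
        (forall x, ~ (\bigcup_(M' in components M) N M') x ->
          gradient h x = 0 -> negative_definite (hessian h x))]) /\
  (exists2 K, compact K & M `<=` K).

Definition uniform_PLcirc (R : realType) (m d : nat) (Theta : set 'rV[R]_m)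
    (g : 'rV[R]_m -> 'rV[R]_d -> R) : Prop :=
  exists2 mu : R, 0 < mu & forall t, Theta t -> PLcirc mu (g t).

Definition sol (R : realType) (m d : nat) (g : 'rV[R]_m -> 'rV[R]_d -> R)
    (t : 'rV[R]_m) : set 'rV[R]_d :=
  argmin setT (g t).

(* R^m x R^d is identified with R^(m+d) through row_mx, whose Euclidean norm is
   that of the pair. *)
Definition cylinder (R : realType) (m d : nat) (Theta : set 'rV[R]_m)
    : set 'rV[R]_(m + d) :=
  [set z | Theta (lsubmx z)].

(* Only the values of f on Theta x R^d are meaningful: G is a C^k extension of
   f to an open neighbourhood of that set. *)
Definition Ck_extension (R : realType) (m d : nat) (k : nat)
    (Theta : set 'rV[R]_m) (f : 'rV[R]_m -> 'rV[R]_d -> R)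
    (G : 'rV[R]_(m + d) -> R) : Prop :=
  (exists U : set 'rV[R]_(m + d),
     [/\ open U, @cylinder R m d Theta `<=` U & Ck k U G]) /\
  (forall t x, Theta t -> G (row_mx t x) = f t x).

Record regularity (R : realType) (m d : nat) (Theta : set 'rV[R]_m)
    (f g : 'rV[R]_m -> 'rV[R]_d -> R) : Prop := Regularity {
  reg_f_C1 : exists G, Ck_extension 1 Theta f G ;
  reg_f_lip : exists Lf1 : R, forall t t' x x', Theta t -> Theta t' ->
    `|f t x - f t' x'| <= Lf1 * enorm (row_mx (t - t') (x - x')) ;
  reg_f_growth : exists (Cf Df : R) (nf : nat),
    [/\ 0 <= Cf, 0 <= Df, (1 <= nf)%N &
        forall t x, Theta t -> `|f t x| <= Cf * enorm x ^+ nf + Df] ;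
  (* off the interior of Theta, the gradient in theta is that of the
     extension *)
  reg_g_C2 : exists G, Ck_extension 2 Theta g G /\
    exists (Cg Dg : R) (ng : nat),
      [/\ 0 <= Cg, 0 <= Dg, (1 <= ng)%N &
          forall t x, Theta t ->
            enorm (gradient (fun s => G (row_mx s x)) t)
              <= Cg * enorm x ^+ ng + Dg] ;
  reg_g_lip_x : exists Lxx : R, forall t x x', Theta t ->
    enorm (gradient (g t) x - gradient (g t) x') <= Lxx * enorm (x - x') ;
  reg_g_lip_t : exists Ltx : R, forall t t' x, Theta t -> Theta t' ->
    enorm (gradient (g t) x - gradient (g t') x) <= Ltx * enorm (t - t') ;
  reg_g_hess_cont : {within @cylinder R m d Theta,
    continuous (fun z : 'rV[R]_(m + d) => hessian (g (lsubmx z)) (rsubmx z))} ;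
  reg_g_hess_lip : exists r3 L3 : R, 0 < r3 /\
    forall t x y, Theta t ->
      (maxe (dist x (sol g t)) (dist y (sol g t)) <= r3%:E)%E ->
      opnorm (hessian (g t) x - hessian (g t) y) <= L3 * enorm (x - y) ;
  reg_g_eb : exists Deb nu : R, [/\ 0 < Deb, 0 < nu &
    forall t x, Theta t -> Deb <= enorm x ->
      (nu%:E * dist x (sol g t) <= (enorm (gradient (g t) x))%:E)%E]
}.

(* Main.v *)
Require Import Defs.
From mathcomp Require Import all_boot all_order all_algebra.
From mathcomp Require Import all_classical all_reals all_analysis.
From mathcomp Require Import ring lra zify.
Import Order.TTheory GRing.Theory Num.Theory.
Import numFieldNormedType.Exports.
Local Open Scope classical_set_scope.
Local Open Scope ring_scope.
Set Implicit Arguments.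
Unset Strict Implicit.
Unset Printing Implicit Defensive.

(** Fix [t], write [h] for the objective [g t], and let [S] be the set of its
    minimizers. The dimension of [S] at a point is the corank of the Hessian
    of [h] there, so the theorem says that this rank depends neither on the
    point nor on [t]. The proof has three ingredients.

    Local structure. The PL inequality gives the error bound [mu / 2 * dist
    (z, S) <= |gradient h z|] near [S] ([PL_error_bound], by Ekeland's
    principle applied to the square root of [h - min h]). Two facts follow by
    comparing a point with a minimizer close to it. The Hessian at a point of
    [S] expands by at least [mu / 2] on the orthogonal of its kernel
    ([PL_hessian_gap]). And near a point of [S] where the Hessian has rank
    [r], suitable [r] combinations of the partial derivatives vanish exactly
    on [S] ([PL_zeros]); they are independent there, so [S] is a submanifold
    of codimension [r] ([PL_embedded_submanifold]).

    Local constancy of the rank. Two matrices with the gap [mu / 2] that are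
    closer than [mu / 2] have the same rank ([gap_rank_eq]): neither kernel
    can contain a nonzero vector orthogonal to the other. Since [mu] does not
    depend on [t] and the Hessian is continuous in both variables, the rank
    is locally constant on the graph of the solution map ([rank_near]).

    Connectedness. Each [S] is connected ([argmin_connected]). Otherwise
    raise the level [c] from the minimum and consider the supremum of the
    levels at which two minimizers [a] and [b] are separated by a closed
    partition of [{h <= c}]. Compactness of the sublevel sets
    ([sublevel_compact]) shows that separation persists slightly above any
    separating level ([sep_lt]). It also persists in the limit from below
    ([sep_lim]), because critical points that are not local minima are
    nondegenerate local maxima, and in dimension at least 2 the points below
    such a maximum can be joined around it. As [a] and [b] are joined by a
    segment, this is absurd. So the rank is constant on each [S]. The
    solution map is locally bounded with closed graph, hence the rank is the
    same for nearby parameters ([rank_param_near]), and it is constant along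
    the segments of the convex set of parameters. *)

(** * Euclidean geometry of row vectors *)

Definition dot (R : realType) (n : nat) (u v : 'rV[R]_n) : R :=
  \sum_(i < n) u ord0 i * v ord0 i.

Lemma dotC (R : realType) n (u v : 'rV[R]_n) : dot u v = dot v u.
Proof. by apply: eq_bigr => i _; rewrite mulrC. Qed.

Lemma dotDl (R : realType) n (u v w : 'rV[R]_n) :
  dot (u + v) w = dot u w + dot v w.
Proof. by rewrite -big_split; apply: eq_bigr => i _; rewrite mxE mulrDl. Qed.

Lemma dotZl (R : realType) n (a : R) (u w : 'rV[R]_n) :
  dot (a *: u) w = a * dot u w.
Proof. by rewrite mulr_sumr; apply: eq_bigr => i _; rewrite mxE mulrA. Qed.

Lemma dotDr (R : realType) n (u v w : 'rV[R]_n) :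
  dot w (u + v) = dot w u + dot w v.
Proof. by rewrite !(dotC w) dotDl. Qed.

Lemma dotZr (R : realType) n (a : R) (u w : 'rV[R]_n) :
  dot w (a *: u) = a * dot w u.
Proof. by rewrite !(dotC w) dotZl. Qed.

Lemma dotNl (R : realType) n (u w : 'rV[R]_n) : dot (- u) w = - dot u w.
Proof. by rewrite -scaleN1r dotZl mulN1r. Qed.

Lemma dotNr (R : realType) n (u w : 'rV[R]_n) : dot w (- u) = - dot w u.
Proof. by rewrite !(dotC w) dotNl. Qed.

Lemma dotBr (R : realType) n (u v w : 'rV[R]_n) :
  dot w (u - v) = dot w u - dot w v.
Proof. by rewrite dotDr dotNr. Qed.

Lemma dotE (R : realType) n (u v : 'rV[R]_n) : dot u v = (u *m v^T) ord0 ord0.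
Proof. by rewrite mxE; apply: eq_bigr => i _; rewrite mxE. Qed.

Lemma dot_delta (R : realType) n (u : 'rV[R]_n) i :
  dot (delta_mx ord0 i) u = u ord0 i.
Proof.
rewrite /dot (bigD1 i)//= mxE !eqxx mul1r big1 ?addr0// => j ji.
by rewrite mxE eqxx (negPf ji) mul0r.
Qed.

Lemma dotvv_ge0 (R : realType) n (u : 'rV[R]_n) : 0 <= dot u u.
Proof. by apply: sumr_ge0 => i _; rewrite -expr2 sqr_ge0. Qed.

Lemma enorm_sqr (R : realType) n (u : 'rV[R]_n) : enorm u ^+ 2 = dot u u.
Proof. by rewrite sqr_sqrtr//; apply: dotvv_ge0. Qed.

Lemma enorm_ge0 (R : realType) n (u : 'rV[R]_n) : 0 <= enorm u.
Proof. exact: sqrtr_ge0. Qed.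

Lemma enorm0 (R : realType) n : enorm (0 : 'rV[R]_n) = 0.
Proof. by rewrite /enorm big1 ?sqrtr0// => i _; rewrite mxE expr0n. Qed.

Lemma ler_coord_enorm (R : realType) n (u : 'rV[R]_n) i :
  `|u ord0 i| <= enorm u.
Proof.
rewrite -sqrtr_sqr ler_wsqrtr// (bigD1 i)//= lerDl.
by apply: sumr_ge0 => j _; exact: sqr_ge0.
Qed.

Lemma enorm_eq0 (R : realType) n (u : 'rV[R]_n) : (enorm u == 0) = (u == 0).
Proof.
apply/eqP/eqP => [u0|->]; last exact: enorm0.
apply/rowP => i; rewrite mxE; apply/eqP; rewrite -normr_le0 -u0.
exact: ler_coord_enorm.
Qed.

Lemma enorm_gt0 (R : realType) n (u : 'rV[R]_n) : (0 < enorm u) = (u != 0).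
Proof. by rewrite lt_def enorm_eq0 enorm_ge0 andbT. Qed.

Lemma enormZ (R : realType) n (a : R) (u : 'rV[R]_n) :
  enorm (a *: u) = `|a| * enorm u.
Proof.
apply/eqP; rewrite -(@eqrXn2 _ 2)// ?mulr_ge0 ?enorm_ge0//.
by rewrite exprMn !enorm_sqr dotZl dotZr mulrA real_normK ?num_real.
Qed.

Lemma enormN (R : realType) n (u : 'rV[R]_n) : enorm (- u) = enorm u.
Proof. by rewrite -scaleN1r enormZ normrN1 mul1r. Qed.

Lemma enormB (R : realType) n (u v : 'rV[R]_n) : enorm (u - v) = enorm (v - u).
Proof. by rewrite -enormN opprB. Qed.

(** Cauchy-Schwarz, from the sign of the squared norm of [|v|^2 u - <u, v>
    v]. *)
Lemma dot_le_enorm (R : realType) n (u v : 'rV[R]_n) :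
  `|dot u v| <= enorm u * enorm v.
Proof.
rewrite -(@ler_pXn2r _ 2)// ?nnegrE ?mulr_ge0 ?enorm_ge0//.
rewrite exprMn !enorm_sqr real_normK ?num_real//.
have [->|v0] := eqVneq v 0.
  have -> : dot u (0 : 'rV_n) = 0 by rewrite -(scale0r u) dotZr mul0r.
  by rewrite expr0n/= mulr_ge0// dotvv_ge0.
have vv : 0 < dot v v by rewrite -enorm_sqr exprn_gt0// enorm_gt0.
have := dotvv_ge0 (dot v v *: u - dot u v *: v).
rewrite !(dotDl, dotDr, dotNl, dotNr, dotZl, dotZr) (dotC v u).
set a := dot u u; set b := dot u v; set c := dot v v => h.
have : 0 <= c * (a * c - b ^+ 2) by nra.
by rewrite pmulr_rge0// subr_ge0.
Qed.

Lemma enormD (R : realType) n (u v : 'rV[R]_n) :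
  enorm (u + v) <= enorm u + enorm v.
Proof.
rewrite -(@ler_pXn2r _ 2)// ?nnegrE ?addr_ge0 ?enorm_ge0//.
rewrite sqrrD !enorm_sqr dotDl !dotDr (dotC v u).
have := le_trans (ler_norm _) (dot_le_enorm u v); lra.
Qed.

Lemma enorm_triangle (R : realType) n (w u v : 'rV[R]_n) :
  enorm (u - v) <= enorm (u - w) + enorm (w - v).
Proof. by rewrite (le_trans _ (enormD _ _))// addrA subrK. Qed.

Lemma enorm_sum (R : realType) n k (F : 'I_k -> 'rV[R]_n) :
  enorm (\sum_(i < k) F i) <= \sum_(i < k) enorm (F i).
Proof.
apply: (big_ind2 (fun x y => enorm x <= y)) => [|x a y b xa yb|//].
  by rewrite enorm0.
by rewrite (le_trans (enormD _ _))// lerD.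
Qed.

Lemma enorm_delta (R : realType) n (i : 'I_n) :
  enorm (delta_mx ord0 i : 'rV[R]_n) = 1.
Proof.
apply/eqP; rewrite -(@eqrXn2 _ 2)// ?enorm_ge0// enorm_sqr dot_delta.
by rewrite mxE !eqxx expr1n.
Qed.

Lemma enorm_le_sum (R : realType) n (u : 'rV[R]_n) :
  enorm u <= \sum_(i < n) `|u ord0 i|.
Proof.
rewrite {1}(row_sum_delta u) (le_trans (enorm_sum _))// ler_sum// => i _.
by rewrite enormZ enorm_delta mulr1.
Qed.

Lemma ler_coord_norm (R : realType) n (u : 'rV[R]_n) i : `|u ord0 i| <= `|u|.
Proof.
by rewrite [leRHS]/Num.norm /= mx_normrE; apply/bigmax_geP; right => /=; exists (ord0, i).
Qed.

Lemma enorm_le_norm (R : realType) n (u : 'rV[R]_n) : enorm u <= n%:R * `|u|.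
Proof.
rewrite (le_trans (enorm_le_sum u))//.
rewrite mulr_natl -[X in _ *+ X]card_ord -sumr_const.
by apply: ler_sum => i _; exact: ler_coord_norm.
Qed.

Lemma norm_le_enorm (R : realType) n (u : 'rV[R]_n) : `|u| <= enorm u.
Proof.
rewrite [leLHS]/Num.norm /= mx_normrE; apply/bigmax_leP; split => [|[j i] _ /=].
  exact: enorm_ge0.
by rewrite ord1 ler_coord_enorm.
Qed.

(** Lets Euclidean balls be used throughout in place of the balls of the sup
    norm that defines the topology. *)
Lemma nbhs_enormP (R : realType) n (x : 'rV[R]_n) (A : set 'rV[R]_n) :
  nbhs x A <-> exists2 e, 0 < e & forall y, enorm (y - x) < e -> A y.
Proof.
split => [/nbhs_ballP[e /= e0 eA]|[e e0 eA]].
  exists e => // y yx; apply: eA; rewrite -ball_normE /=.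
  by rewrite distrC (le_lt_trans (norm_le_enorm _)).
apply/nbhs_ballP; exists (e / n.+1%:R); first by rewrite /= divr_gt0.
move=> y; rewrite -ball_normE /= distrC ltr_pdivlMr// => yx; apply: eA.
rewrite (le_lt_trans (enorm_le_norm _))// (le_lt_trans _ yx)// mulrC.
by rewrite ler_wpM2l// ler_nat.
Qed.

Lemma nbhs_enorm (R : realType) n (x : 'rV[R]_n) e :
  0 < e -> nbhs x [set y | enorm (y - x) < e].
Proof. by move=> e0; apply/nbhs_enormP; exists e. Qed.

Lemma open_enormP (R : realType) n (U : set 'rV[R]_n) :
  open U <-> forall x, U x ->
    exists2 e, 0 < e & forall y, enorm (y - x) < e -> U y.
Proof.
by rewrite openE; split=> oU x /oU /nbhs_enormP.
Qed.

Lemma open_eball (R : realType) n (x : 'rV[R]_n) e :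
  open [set y | enorm (y - x) < e].
Proof.
apply/open_enormP => y /= yx; exists (e - enorm (y - x)); first lra.
by move=> z zy; have := enorm_triangle y z x; lra.
Qed.

Lemma continuous_enormP (R : realType) n (f : 'rV[R]_n -> R) (x : 'rV[R]_n) :
  {for x, continuous f} <-> forall e, 0 < e ->
    exists2 d, 0 < d & forall y, enorm (y - x) < d -> `|f y - f x| < e.
Proof.
split=> [fx e e0|fx].
  have /nbhs_enormP[d d0 dP] : nbhs x [set y | `|f x - f y| < e].
    by move/cvgrPdist_lt : fx; exact.
  by exists d => // y /dP /=; rewrite distrC.
apply/(@cvgrPdist_lt _ _ _ (nbhs x)) => e /fx[d d0 dP]; apply/nbhs_enormP; exists d => // y /dP.
by rewrite distrC.
Qed.

Lemma continuous_enorm (R : realType) n (x : 'rV[R]_n) :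
  continuous (fun y : 'rV[R]_n => enorm (y - x)).
Proof.
move=> y; apply/continuous_enormP => e e0; exists e => // z zy.
have := enorm_triangle y z x; have := enorm_triangle z y x.
by rewrite (enormB y z) => h1 h2; rewrite ltr_norml; apply/andP; split; lra.
Qed.

Lemma closed_bounded_compact (R : realType) n (A : set 'rV[R]_n) (M : R) :
  closed A -> (forall x, A x -> enorm x <= M) -> compact A.
Proof.
move=> cA AM; apply: bounded_closed_compact => //.
exists M; split; first exact: num_real.
by move=> y My x /AM xM; apply: (le_trans (norm_le_enorm x)); rewrite (le_trans xM) ?ltW.
Qed.

Lemma compact_enorm_bounded (R : realType) n (K : set 'rV[R]_n) :
  compact K -> exists2 M, 0 < M & forall x, K x -> enorm x <= M.
Proof.
move=> /compact_bounded/ex_strict_bound_gt0[M M0 KM].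
exists (n.+1%:R * M) => [|x /KM /= xM]; first by rewrite mulr_gt0.
rewrite (le_trans (enorm_le_norm _))// ler_pM// ?ler_nat//; exact: ltW.
Qed.

Lemma compact_eball (R : realType) n (x : 'rV[R]_n) e :
  compact [set y | enorm (y - x) <= e].
Proof.
apply: (@closed_bounded_compact _ _ _ (e + enorm x)); last first.
  by move=> y /= yx; have := enormD (y - x) x; rewrite subrK; lra.
apply: (@closed_comp _ _ (fun y : 'rV[R]_n => enorm (y - x)) [set t | t <= e]).
  by move=> y _; exact: continuous_enorm.
exact: closed_le.
Qed.

Lemma compact_min (R : realType) n (f : 'rV[R]_n -> R) (K : set 'rV[R]_n) :
  K !=set0 -> compact K -> continuous f ->
  exists2 c, K c & forall x, K x -> f c <= f x.
Proof.
move=> K0 cK cf.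
have [c cK' cP] := EVT_min_rV K0 cK (continuous_subspaceT cf).
exists c; first by rewrite inE in cK'.
by move=> x xK; apply: cP; rewrite inE.
Qed.

(** * Gradients, Hessians and strict differentiability *)

Lemma derive_gradient (R : realType) n (f : 'rV[R]_n -> R) x v :
  differentiable f x -> 'D_v f x = dot v (gradient f x).
Proof.
move=> df; rewrite deriveE// {1}(row_sum_delta v) linear_sum.
by apply: eq_bigr => i _; rewrite linearZ/= -deriveE// mxE.
Qed.

Lemma is_derive_line (R : realType) n (f : 'rV[R]_n -> R) x v (t : R) :
  differentiable f (x + t *: v) ->
  is_derive t 1 (fun s : R => f (x + s *: v)) ('D_v f (x + t *: v)).
Proof.
move=> df.
have E : (fun h : R => h^-1 *: (f (x + (h *: 1 + t) *: v) - f (x + t *: v))) =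
    (fun h : R => h^-1 *: (f (h *: v + (x + t *: v)) - f (x + t *: v))).
  by apply/funext => h; rewrite addrCA -scalerDl /GRing.scale /= mulr1.
have := diff_derivable (v := v) df; rewrite /derivable => dv.
apply: DeriveDef; first by rewrite /derivable E.
by rewrite /derive E.
Qed.

Lemma MVT_line (R : realType) n (f : 'rV[R]_n -> R) x v :
  (forall y, differentiable f y) ->
  exists2 t : R, 0 < t < 1 & f (x + v) - f x = dot v (gradient f (x + t *: v)).
Proof.
move=> df; pose g (s : R) := f (x + s *: v).
have dg t : is_derive t (1 : R) g ('D_v f (x + t *: v)) by exact: is_derive_line.
have cg : {within `[0, 1], continuous g}.
  apply: continuous_subspaceT => t; apply/differentiable_continuous.
  exact/derivable1_diffP.
have [t t01] := MVT ltr01 (fun t _ => dg t) cg.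
rewrite /g scale0r addr0 scale1r subr0 mulr1 => ->.
exists t; first by rewrite in_itv/= in t01.
exact: derive_gradient.
Qed.

Lemma continuous_row_enorm (R : realType) n k (F : 'rV[R]_n -> 'rV[R]_k) x :
  (forall j, {for x, continuous (fun y => F y ord0 j)}) ->
  forall e, 0 < e ->
  exists2 d, 0 < d & forall y, enorm (y - x) < d -> enorm (F y - F x) < e.
Proof.
move=> cF e e0; apply/nbhs_enormP.
have e0' : 0 < e / k.+1%:R by rewrite divr_gt0.
have : nbhs x [set y | forall j, `|F y ord0 j - F x ord0 j| < e / k.+1%:R].
  apply: (filter_forall (F := nbhs x)) => j.
  by apply/nbhs_enormP; have /continuous_enormP := cF j; exact.
apply: filterS => y /= yP; rewrite (le_lt_trans (enorm_le_sum _))//.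
apply: (@le_lt_trans _ _ (\sum_(j < k) e / k.+1%:R)).
  by apply: ler_sum => j _; rewrite !mxE ltW.
rewrite sumr_const card_ord -[X in X < _]mulr_natl mulrCA gtr_pMr// ltr_pdivrMr//.
by rewrite mul1r ltr_nat.
Qed.

Lemma gradient_continuous (R : realType) n (f : 'rV[R]_n -> R) x :
  Ck 1 setT f -> forall e, 0 < e ->
  exists2 d, 0 < d & forall y, enorm (y - x) < d ->
    enorm (gradient f y - gradient f x) < e.
Proof.
move=> [_ cf]; apply: continuous_row_enorm => j.
rewrite (_ : (fun y => _) = 'D_(delta_mx ord0 j) f); first exact: cf.
by apply/funext => y; rewrite mxE.
Qed.

Definition seg (R : realType) n (a b : 'rV[R]_n) : set 'rV[R]_n :=
  [set a + t *: (b - a) | t in `[0, 1]%classic].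

Lemma seg_ball (R : realType) n (p a b x : 'rV[R]_n) d :
  enorm (a - p) < d -> enorm (b - p) < d -> seg a b x -> enorm (x - p) < d.
Proof.
move=> ad bd [t]; rewrite /= in_itv/= => /andP[t0 t1] <-.
have -> : a + t *: (b - a) - p = (1 - t) *: (a - p) + t *: (b - p).
  by apply/rowP => i; rewrite !mxE; ring.
rewrite (le_lt_trans (enormD _ _))// !enormZ !ger0_norm ?subr_ge0//.
have A0 := enorm_ge0 (a - p); have B0 := enorm_ge0 (b - p).
by have [|] := leP t (1 / 2) => ?; nra.
Qed.

(** The mean value theorem writes the increment of [f] along [x, y] with the
    gradient at an intermediate point, which is close to the gradient at
    [x0]. *)
Lemma strict_diff (R : realType) n (f : 'rV[R]_n -> R) x0 :
  Ck 1 setT f -> forall e, 0 < e ->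
  exists2 d, 0 < d & forall x y, enorm (x - x0) < d -> enorm (y - x0) < d ->
    `|f y - f x - dot (y - x) (gradient f x0)| <= e * enorm (y - x).
Proof.
move=> f1 e e0; have [d d0 dP] := gradient_continuous x0 f1 e0.
exists d => // x y xd yd; have [df _] := f1.
have [t t01] := @MVT_line _ _ f x (y - x) (fun z => df z I).
rewrite subrKC => ->; rewrite -dotBr (le_trans (dot_le_enorm _ _))//.
rewrite mulrC ler_wpM2r ?enorm_ge0// ltW// dP//; apply: (seg_ball xd yd).
by case/andP: t01 => t0 t1; exists t => //=; rewrite in_itv/= !ltW.
Qed.

Lemma Ck_le (R : realType) (V W : normedModType R) k (U : set V) (F : V -> W) :
  Ck k.+1 U F -> Ck k U F.
Proof.
elim: k F => [|k IH] F [dF DF] /=.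
  by move=> x Ux; exact/differentiable_continuous/dF.
by split=> // v; exact: IH.
Qed.

Lemma mul_hessian (R : realType) n (h : 'rV[R]_n -> R) x v j :
  (v *m hessian h x) ord0 j = dot v (gradient ('D_(delta_mx ord0 j) h) x).
Proof. by rewrite mxE; apply: eq_bigr => i _; rewrite !mxE. Qed.

(** Strict differentiability of each partial derivative; the common radius is
    the least of the finitely many ones. With the Hessian convention, row
    vectors act on the left: the derivative of the gradient along [v] is [v
    *m H]. *)
Lemma gradient_strict_diff (R : realType) n (h : 'rV[R]_n -> R) x0 :
  Ck 2 setT h -> forall e, 0 < e ->
  exists2 d, 0 < d & forall x y, enorm (x - x0) < d -> enorm (y - x0) < d ->
    enorm (gradient h y - gradient h x - (y - x) *m hessian h x0)
      <= e * enorm (y - x).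
Proof.
move=> [_ h2] e e0; have e0' : 0 < e / n.+1%:R by rewrite divr_gt0.
have /choice[D DP] j : exists d, 0 < d /\
    forall x y, enorm (x - x0) < d -> enorm (y - x0) < d ->
    `|'D_(delta_mx ord0 j) h y - 'D_(delta_mx ord0 j) h x
      - dot (y - x) (gradient ('D_(delta_mx ord0 j) h) x0)|
      <= e / n.+1%:R * enorm (y - x).
  by have [d d0 dP] := strict_diff x0 (h2 (delta_mx ord0 j)) e0'; exists d.
have /nbhs_enormP[d d0 dP] : nbhs x0 [set z | forall j, enorm (z - x0) < D j].
  by apply: (filter_forall (F := nbhs x0)) => j; apply: nbhs_enorm; case: (DP j).
exists d => // x y xd yd; rewrite (le_trans (enorm_le_sum _))//.
apply: (@le_trans _ _ (\sum_(j < n) e / n.+1%:R * enorm (y - x))).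
  apply: ler_sum => j _; rewrite [in leLHS]mxE [X in `|_ + X|]mxE mul_hessian !mxE.
  by apply: (DP j).2; exact: dP.
rewrite sumr_const card_ord -[X in X <= _]mulr_natl mulrA ler_wpM2r ?enorm_ge0//.
by rewrite mulrCA ger_pMr// ler_pdivrMr// mul1r ler_nat.
Qed.

(** * Error bound and Hessian gap at the minimizers *)

Lemma mulmx_enorm_bounded (R : realType) n k (A : 'M[R]_(n, k)) :
  exists2 p, 0 < p & forall v : 'rV[R]_n, enorm (v *m A) <= p * enorm v.
Proof.
exists (1 + \sum_(i < n) enorm (row i A)).
  by rewrite ltr_wpDr// sumr_ge0// => i _; exact: enorm_ge0.
move=> v; rewrite mulmx_sum_row (le_trans (enorm_sum _))// mulrDl mul1r.
rewrite -[leLHS]add0r lerD ?enorm_ge0// mulr_suml ler_sum// => i _.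
by rewrite enormZ mulrC ler_wpM2l ?enorm_ge0// ler_coord_enorm.
Qed.

(** Moving from [y] against the gradient lowers [f] at a rate close to the
    norm of the gradient, so that norm is at most the descent rate allowed at
    [y]. *)
Lemma gradient_le_slope (R : realType) n (f : 'rV[R]_n -> R) y c d :
  Ck 1 setT f -> 0 <= c -> 0 < d ->
  (forall z, enorm (z - y) < d -> f y - c * enorm (z - y) <= f z) ->
  enorm (gradient f y) <= c.
Proof.
move=> f1 c0 d0 fP; rewrite leNgt; apply/negP; set g := gradient f y => cG.
have e0 : 0 < (enorm g - c) / 2 by lra.
have [d1 d10 d1P] := strict_diff y f1 e0.
have G0 : 0 < enorm g by lra.
pose m := Num.min d d1; have m0 : 0 < m by rewrite lt_min d0.
pose s := m / 2 / enorm g.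
have s0 : 0 < s by rewrite !divr_gt0.
pose z := y + - s *: g.
have zyE : z - y = - s *: g by rewrite /z addrC addKr.
have zy : enorm (z - y) = m / 2.
  by rewrite zyE enormZ normrN gtr0_norm// /s divfK// gt_eqF.
have md : m <= d by rewrite ge_min lexx.
have md1 : m <= d1 by rewrite ge_min lexx orbT.
have zd : enorm (z - y) < d by rewrite zy; lra.
have zd1 : enorm (z - y) < d1 by rewrite zy; lra.
have yd1 : enorm (y - y) < d1 by rewrite subrr enorm0.
have := d1P y z yd1 zd1; have := fP z zd.
rewrite zyE dotZl -enorm_sqr -/g -zyE zy ler_norml => h1 /andP[_ h2].
have e1 : s * enorm g = m / 2 by rewrite /s divfK// gt_eqF.
have e2 : s * enorm g ^+ 2 = m / 2 * enorm g by rewrite expr2 mulrA e1.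
by nra.
Qed.

Lemma local_min_gradient (R : realType) n (f : 'rV[R]_n -> R) y :
  Ck 1 setT f -> local_minima f y -> gradient f y = 0.
Proof.
move=> f1 /nbhs_enormP[d d0 dP]; apply/eqP; rewrite -enorm_eq0.
rewrite eq_le enorm_ge0 andbT; apply: (@gradient_le_slope _ _ _ _ _ d) => //.
by move=> z /dP; rewrite mul0r subr0.
Qed.

Lemma argmin_gradient (R : realType) n (f : 'rV[R]_n -> R) y :
  Ck 1 setT f -> (forall z, f y <= f z) -> gradient f y = 0.
Proof. by move=> f1 yP; apply: (local_min_gradient f1); apply: filterS filterT => z _. Qed.

(** Ekeland's principle in finite dimension: minimize [f + c |. - x|] over
    the closed ball. The bound on [f x - m] keeps the minimizer in the
    interior. *)
Lemma ekeland_ball (R : realType) n (f : 'rV[R]_n -> R) x r c m :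
  continuous f -> 0 < c -> 0 < r -> (forall z, m <= f z) -> f x - m < c * r ->
  exists y, [/\ enorm (y - x) < r, f y + c * enorm (y - x) <= f x &
    forall z, enorm (z - x) <= r -> f y - c * enorm (z - y) <= f z].
Proof.
move=> cf c0 r0 mf fx; pose g z := f z + c * enorm (z - x).
have [] := @compact_min _ _ g [set z | enorm (z - x) <= r].
- by exists x; rewrite /= subrr enorm0 ltW.
- exact: compact_eball.
- move=> z; apply: (@continuousD R R _ f (fun z => c * enorm (z - x))).
    exact: cf.
  by apply: continuousM; [exact: cst_continuous|exact: continuous_enorm].
move=> y /= yx yP.
have gy : f y + c * enorm (y - x) <= f x.
  have := yP x; rewrite /g subrr enorm0 mulr0 addr0; apply; exact: ltW.
exists y; split=> //.
  by have := mf y; rewrite -(ltr_pM2l c0); lra.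
move=> z /yP; rewrite /g; have := enorm_triangle y z x.
rewrite -(ler_pM2l c0) mulrDr => h; lra.
Qed.

(** The PL inequality says that [phi = sqrt (h - h x0)] has slope at least
    [sqrt (mu / 2)] wherever [phi] is positive. Ekeland's principle for [phi]
    with a smaller slope [c] therefore stops at a zero of [phi], that is at a
    minimizer [y], and gives [c |z - y| <= phi z]; a second use of the PL
    inequality bounds [phi z] by the gradient. *)
Lemma PL_error_bound (R : realType) n (h : 'rV[R]_n -> R) mu x0 d0 e :
  Ck 1 setT h -> 0 < mu -> (forall y, h x0 <= h y) ->
  0 < d0 ->
  (forall z, enorm (z - x0) < d0 ->
     h z - h x0 <= (2 * mu)^-1 * enorm (gradient h z) ^+ 2) ->
  0 < e ->
  exists2 d, 0 < d & forall z, enorm (z - x0) < d ->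
    exists y, [/\ enorm (y - x0) < e, h y = h x0 &
      mu / 2 * enorm (z - y) <= enorm (gradient h z)].
Proof.
move=> h1 mu0 x0min d00 PL e0.
have hc : continuous h by move=> x; exact/differentiable_continuous/h1.1.
pose phi z := Num.sqrt (h z - h x0).
have cphi : continuous phi.
  move=> z; apply: (@continuous_comp _ _ _ (fun z => h z - h x0) Num.sqrt).
    by apply: continuousB; [exact: hc|exact: cst_continuous].
  exact: sqrt_continuous.
have phi2 z : phi z ^+ 2 = h z - h x0 by rewrite sqr_sqrtr// subr_ge0.
have phi0 z : 0 <= phi z by exact: sqrtr_ge0.
pose r := Num.min d0 e / 2; have m0 : 0 < Num.min d0 e by rewrite lt_min d00.
have r0 : 0 < r by rewrite divr_gt0.
have rd0 : 2 * r <= d0 by rewrite mulrC divfK// ge_min lexx.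
have re : 2 * r <= e by rewrite mulrC divfK// ge_min lexx orbT.
(* below the slope sqrt (mu / 2), yet large enough for the final constant *)
pose c := Num.sqrt mu / 2; have c0 : 0 < c by rewrite divr_gt0// sqrtr_gt0.
have c2 : 4 * c ^+ 2 = mu.
  by rewrite /c expr_div_n sqr_sqrtr ?ltW//; field.
have /continuous_enormP/(_ (c * r)) := cphi x0.
case=> [|d d_gt0 dP]; first by rewrite mulr_gt0.
exists (Num.min d r); first by rewrite lt_min d_gt0.
move=> z; rewrite lt_min => /andP[zd zr].
have phix0 : phi x0 = 0 by rewrite /phi subrr sqrtr0.
have [|y [yz phiy yP]] := ekeland_ball (x := z) cphi c0 r0 phi0.
  rewrite subr0 (le_lt_trans (ler_norm _))//.
  by have := dP z zd; rewrite phix0 subr0.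
have yx0 : enorm (y - x0) < 2 * r by have := enorm_triangle z y x0; lra.
have muN0 : mu != 0 by rewrite gt_eqF.
have hy : phi y = 0.
  apply/eqP; rewrite eq_le phi0 andbT leNgt; apply/negP => a0.
  have slope : enorm (gradient h y) <= 2 * phi y * c.
    apply: (@gradient_le_slope _ _ _ _ _ (r - enorm (y - z))) => //.
    - by rewrite !mulr_ge0// ltW.
    - lra.
    - move=> w wy; have /yP : enorm (w - z) <= r.
        by have := enorm_triangle y w z; lra.
      move=> hw; suff : phi y ^+ 2 - 2 * phi y * c * enorm (w - y) <= phi w ^+ 2.
        by rewrite !phi2; lra.
      have := phi0 w; move: (phi y) (phi w) (enorm_ge0 (w - y)) hw a0.
      move=> a b t0; set s := c * enorm (w - y) => hw a0 b0.
      have -> : 2 * a * c * enorm (w - y) = 2 * a * s by rewrite /s; ring.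
      have s0 : 0 <= s by rewrite mulr_ge0// ltW.
      by have [|] := leP s a => ?; nra.
  have := PL y; rewrite -phi2 => /(_ _)/wrap[|]; first lra.
  rewrite leNgt => /negP; apply; rewrite mulrC ltr_pdivrMr ?mulr_gt0//.
  have : enorm (gradient h y) ^+ 2 <= (2 * phi y * c) ^+ 2.
    by rewrite ler_pXn2r// nnegrE ?enorm_ge0// !mulr_ge0// ltW.
  have -> : (2 * phi y * c) ^+ 2 = phi y ^+ 2 * (4 * c ^+ 2) by ring.
  rewrite c2 => /le_lt_trans; apply.
  by rewrite ltr_pM2l ?exprn_gt0//; lra.
exists y; split; first lra.
  by apply/eqP; rewrite -subr_eq0 -phi2 hy expr0n.
have zd0 : enorm (z - x0) < d0 by lra.
move: (PL z zd0); rewrite -phi2 mulrC ler_pdivlMr ?mulr_gt0// => PLz.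
move: phiy; rewrite hy add0r enormB => phiz.
rewrite -(@ler_pXn2r _ 2)// ?nnegrE ?mulr_ge0 ?enorm_ge0//; last 1 first.
  by rewrite ltW// divr_gt0.
apply: le_trans PLz.
have : (c * enorm (z - y)) ^+ 2 <= phi z ^+ 2.
  by rewrite ler_pXn2r// nnegrE// mulr_ge0 ?enorm_ge0// ltW.
rewrite exprMn => hh.
have muT : mu * enorm (z - y) ^+ 2 <= 4 * phi z ^+ 2 by rewrite -c2; lra.
have -> : (mu / 2 * enorm (z - y)) ^+ 2 = mu * (mu * enorm (z - y) ^+ 2) / 4.
  by field.
have := sqr_ge0 (phi z); rewrite -(ler_pM2l mu0) in muT; nra.
Qed.

(** Pythagoras: 0 is the point closest to [v] on the line spanned by [k]. *)
Lemma dot_orth_le (R : realType) n (v k : 'rV[R]_n) :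
  dot v k = 0 -> enorm v <= enorm (v - k).
Proof.
move=> vk; rewrite -(@ler_pXn2r _ 2)// ?nnegrE ?enorm_ge0// !enorm_sqr.
rewrite !(dotDl, dotDr, dotNl, dotNr) (dotC k v) vk.
by have := dotvv_ge0 k; lra.
Qed.

(** On the orthogonal of its kernel the Hessian expands by at least [mu / 2].
    Move from [x0] to [z = x0 + t v] and take the minimizer [y] given by the
    error bound at [z]. To first order in [t], the gradient at [z] is [t (v
    H)] and [w = y - x0] lies in the kernel of [H], because the gradient
    vanishes at both ends. As [v] is orthogonal to the kernel, [t |v| <= |t v
    - w| = |z - y|], which the error bound compares with [t |v H|]. *)
Lemma PL_hessian_gap (R : realType) n (h : 'rV[R]_n -> R) mu x0 d0 v :
  Ck 2 setT h -> 0 < mu -> (forall y, h x0 <= h y) ->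
  0 < d0 ->
  (forall z, enorm (z - x0) < d0 ->
     h z - h x0 <= (2 * mu)^-1 * enorm (gradient h z) ^+ 2) ->
  (forall u, u *m hessian h x0 = 0 -> dot v u = 0) ->
  mu / 2 * enorm v <= enorm (v *m hessian h x0).
Proof.
move=> h2 mu0 x0min d00 PL vker; have h1 := Ck_le h2.
set H := hessian h x0 in vker *; set G := enorm (v *m H).
have [p p0 pP] := mulmx_enorm_bounded (pinvmx H).
set k := mu / 2; have k0 : 0 < k by rewrite divr_gt0.
pose K := (G + enorm v) / k + enorm v.
have K0 : 0 <= K by rewrite addr_ge0 ?enorm_ge0// divr_ge0 ?addr_ge0 ?enorm_ge0// ltW.
(* e is the modulus of strict differentiability at x0; it tends to 0 *)
suff key e : 0 < e -> e <= 1 -> k * enorm v <= G + e * (enorm v + k * p * K).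
  apply/ler_addgt0Pr => e e0; set C := enorm v + k * p * K in key.
  have C0 : 0 <= C by rewrite addr_ge0 ?enorm_ge0// !mulr_ge0// ltW.
  have e'0 : 0 < Num.min 1 (e / (C + 1)) by rewrite lt_min ltr01 divr_gt0//; lra.
  rewrite (le_trans (key _ e'0 _)) ?ge_min ?lexx// lerD2l.
  have : Num.min 1 (e / (C + 1)) * (C + 1) <= e.
    by rewrite -ler_pdivlMr ?ge_min ?lexx ?orbT//; lra.
  by nra.
move=> e0 e1; have [d1 d10 d1P] := gradient_strict_diff x0 h2 e0.
have [d2 d20 d2P] := PL_error_bound h1 mu0 x0min d00 PL d10.
pose m := Num.min d1 d2; have m0 : 0 < m by rewrite lt_min d10.
have md1 : m <= d1 by rewrite ge_min lexx.
have md2 : m <= d2 by rewrite ge_min lexx orbT.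
pose t := m / (enorm v + 1).
have t0 : 0 < t by rewrite divr_gt0// ltr_wpDl// enorm_ge0.
have tv : t * enorm v < m.
  by rewrite /t mulrAC ltr_pdivrMr; have := enorm_ge0 v; [nra|lra].
pose z := x0 + t *: v.
have zx0 : z - x0 = t *: v by rewrite /z addrC addKr.
have zx0n : enorm (z - x0) = t * enorm v by rewrite zx0 enormZ gtr0_norm.
have g0 : gradient h x0 = 0 by exact: argmin_gradient.
have x0x0 : enorm (x0 - x0) < d1 by rewrite subrr enorm0.
have gz : enorm (gradient h z) <= t * (G + e * enorm v).
  have := d1P x0 z x0x0; rewrite zx0n g0 subr0 zx0 -scalemxAl => /(_ _)/wrap[|hz].
    lra.
  have := enormD (gradient h z - t *: (v *m H)) (t *: (v *m H)).
  rewrite subrK enormZ gtr0_norm// -/G; lra.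
have [|y [yx0 hy yz]] := d2P z; first by rewrite zx0n; lra.
rewrite -/k in yz.
have gy : gradient h y = 0 by apply: (argmin_gradient h1) => w; rewrite hy.
have yK : enorm (y - x0) <= t * K.
  have := enorm_triangle z y x0; rewrite zx0n (enormB y z) => hh.
  rewrite (le_trans hh)// /K mulrDr lerD2r mulrA ler_pdivlMr// mulrC.
  rewrite (le_trans yz)// (le_trans gz)// ler_pM2l// lerD2l.
  by rewrite ler_piMl ?enorm_ge0.
have := d1P x0 y x0x0 yx0; rewrite g0 gy subr0 sub0r enormN -/H => yH.
(* the projection of w to the kernel; its error is controlled by w H *)
pose w := y - x0; pose u := w - w *m H *m pinvmx H.
have uH : u *m H = 0.
  by rewrite mulmxBl mulmxKpV ?subrr// submxMl.
have vu : dot (t *: v) u = 0 by rewrite dotZl vker// mulr0.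
have := dot_orth_le vu.
rewrite enormZ gtr0_norm// => tvu.
have := enormD (t *: v - w) (w *m H *m pinvmx H).
have -> : t *: v - w + w *m H *m pinvmx H = t *: v - u.
  by rewrite /u; apply/rowP => i; rewrite !mxE; ring.
have -> : t *: v - w = z - y.
  by rewrite /w /z; apply/rowP => i; rewrite !mxE; ring.
have := pP (w *m H); rewrite -/w in yH yK.
move=> b1 b2; rewrite -(ler_pM2l t0).
have b3 : enorm (w *m H *m pinvmx H) <= p * (e * (t * K)).
  by rewrite (le_trans b1)// ler_pM2l// (le_trans yH)// ler_pM2l.
have b4 : k * (t * enorm v) <= k * (enorm (z - y) + p * (e * (t * K))).
  by rewrite ler_pM2l//; lra.
by nra.
Qed.

(** * The set of minimizers as a submanifold *)

(** The columns of [H C] form a basis of the column space of [H], so a row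
    vector that [H C] nearly kills is nearly killed by [H]. *)
Lemma rank_factor (F : fieldType) n r (H : 'M[F]_n) : \rank H = r ->
  exists (C : 'M[F]_(n, r)) (D : 'M[F]_(r, n)),
    H *m C *m D = H /\ \rank (H *m C) = r.
Proof.
move=> <-; exists (pinvmx (row_base H)), (row_base H).
have HC : H *m pinvmx (row_base H) = col_base H.
  by rewrite -[X in X *m _]mulmx_base -mulmxA mulmxVp ?row_base_free ?mulmx1.
by rewrite HC mulmx_base; split=> //; apply/eqP; exact: col_base_full.
Qed.

(** The [r] equations [gradient h z *m C = 0] already force [z] to be a
    minimizer. Let [y] be the minimizer that the error bound gives at [z].
    The equations hold at [y] and [z], so [(z - y) H C] is negligible with
    respect to [|z - y|], hence so is [(z - y) H], hence so is the gradient
    at [z]; the error bound then leaves only [z = y]. *)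
Lemma PL_zeros (R : realType) n r (h : 'rV[R]_n -> R) mu x0 d0
    (C : 'M[R]_(n, r)) (D : 'M[R]_(r, n)) :
  Ck 2 setT h -> 0 < mu -> (forall y, h x0 <= h y) -> 0 < d0 ->
  (forall z, enorm (z - x0) < d0 ->
     h z - h x0 <= (2 * mu)^-1 * enorm (gradient h z) ^+ 2) ->
  hessian h x0 *m C *m D = hessian h x0 ->
  exists2 d, 0 < d & forall z, enorm (z - x0) < d ->
    (h z = h x0 <-> gradient h z *m C = 0).
Proof.
move=> h2 mu0 x0min d00 PL HCD; have h1 := Ck_le h2.
set H := hessian h x0 in HCD.
have [q q0 qP] := mulmx_enorm_bounded (C *m D).
set k := mu / 2; have k0 : 0 < k by rewrite divr_gt0.
pose e := k / (2 * (q + 1)); have e0 : 0 < e by rewrite divr_gt0//; lra.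
have ek : (q + 1) * e = k / 2 by rewrite /e; field; lra.
have [d1 d10 d1P] := gradient_strict_diff x0 h2 e0.
have [d2 d20 d2P] := PL_error_bound h1 mu0 x0min d00 PL d10.
exists (Num.min d1 d2); first by rewrite lt_min d10.
move=> z; rewrite lt_min => /andP[zd1 zd2]; split=> [hz|sC].
  by rewrite (argmin_gradient h1) ?mul0mx// => y; rewrite hz.
have [y [yd1 hy yz]] := d2P z zd2.
have gy : gradient h y = 0 by apply: (argmin_gradient h1) => w; rewrite hy.
have := d1P y z yd1 zd1; rewrite gy subr0 -/H => sH.
set s := gradient h z in sC yz sH.
have wH : enorm ((z - y) *m H) <= q * (e * enorm (z - y)).
  have -> : (z - y) *m H = - ((s - (z - y) *m H) *m (C *m D)).
    by rewrite [in RHS]mulmxBl !mulmxA sC mul0mx sub0r opprK -!mulmxA (mulmxA H) HCD.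
  by rewrite enormN (le_trans (qP _))// ler_pM2l.
suff /eqP : enorm (z - y) = 0 by rewrite enorm_eq0 subr_eq0 => /eqP ->.
have := enormD (s - (z - y) *m H) ((z - y) *m H); rewrite subrK => hs.
apply/eqP; rewrite eq_le enorm_ge0 andbT -(pmulr_rle0 _ k0).
by rewrite -/k in yz; nra.
Qed.

Lemma Ck_subset (R : realType) (V W : normedModType R) k (U U' : set V)
  (F : V -> W) : U' `<=` U -> Ck k U F -> Ck k U' F.
Proof.
move=> UU'; elim: k F => [|k IH] F /=; first by move=> cF x /UU' /cF.
by move=> [dF DF]; split=> [x /UU' /dF//|v]; exact: IH.
Qed.

Section lincomb.
Variables (R : realType) (V W : normedModType R) (n : nat).
Implicit Types (f : 'I_n -> V -> R) (w : 'I_n -> W).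

Lemma lincombE f w : (fun z => \sum_(i < n) f i z *: w i) =
  \sum_(i < n) (fun z => f i z *: w i).
Proof. by apply/funext => z; rewrite fct_sumE. Qed.

Lemma differentiable_lincomb f w x : (forall i, differentiable (f i) x) ->
  differentiable (fun z => \sum_(i < n) f i z *: w i) x.
Proof.
move=> df; rewrite lincombE; apply: differentiable_sum => i.
exact: differentiableZl.
Qed.

Lemma derive_lincomb f w x v : (forall i, differentiable (f i) x) ->
  'D_v (fun z => \sum_(i < n) f i z *: w i) x = \sum_(i < n) 'D_v (f i) x *: w i.
Proof.
move=> df; rewrite lincombE derive_sum => [|i].
  apply: eq_bigr => i _; rewrite deriveE; last exact: differentiableZl.
  by rewrite diffZl// -deriveE.
by apply: diff_derivable; exact: differentiableZl.
Qed.

Lemma continuous_lincomb f w x : (forall i, {for x, continuous (f i)}) ->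
  {for x, continuous (fun z => \sum_(i < n) f i z *: w i)}.
Proof.
move=> cf; rewrite lincombE; elim/big_ind : _ => [|g h cg ch|i _].
- exact: cst_continuous.
- by apply: continuousD; [exact: cg|exact: ch].
- by apply: continuousZr_tmp; exact: cf.
Qed.

(** The first derivative of the sum is a sum of derivatives everywhere; the
    second one only on [U], which suffices for its continuity there because
    [U] is open. *)
Lemma C2_lincomb U f w : open U -> (forall i, Ck 1 setT (f i)) ->
  (forall i, Ck 2 U (f i)) -> Ck 2 U (fun z => \sum_(i < n) f i z *: w i).
Proof.
move=> oU f1 f2; split=> [x Ux|v].
  by apply: differentiable_lincomb => i; exact: (f1 i).1.
have -> : 'D_v (fun z => \sum_(i < n) f i z *: w i) =
    (fun z => \sum_(i < n) 'D_v (f i) z *: w i).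
  by apply/funext => z; apply: derive_lincomb => i; exact: (f1 i).1.
split=> [x Ux|u x Ux].
  by apply: differentiable_lincomb => i; exact: ((f2 i).2 v).1.
suff : (fun z => \sum_(i < n) 'D_u ('D_v (f i)) z *: w i) @ x -->
    'D_u (fun z => \sum_(i < n) 'D_v (f i) z *: w i) x.
  apply: cvg_trans; apply: near_eq_cvg.
  have := open_nbhs_nbhs (conj oU Ux); apply: filterS => z Uz.
  by rewrite derive_lincomb// => i; exact: ((f2 i).2 v).1.
rewrite derive_lincomb; last by move=> i; exact: ((f2 i).2 v).1.
by apply: continuous_lincomb => i; exact: ((f2 i).2 v).2.
Qed.

End lincomb.

Lemma mulmx_gradient (R : realType) n r (h : 'rV[R]_n -> R) (C : 'M[R]_(n, r)) :
  (fun z => gradient h z *m C) =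
  (fun z => \sum_(i < n) 'D_(delta_mx ord0 i) h z *: row i C).
Proof.
apply/funext => z; rewrite mulmx_sum_row.
by apply: eq_bigr => i _; rewrite mxE.
Qed.

Lemma jacobian_mulmx_gradient (R : realType) n r (h : 'rV[R]_n -> R) x
    (C : 'M[R]_(n, r)) : Ck 2 setT h ->
  'J (fun z => gradient h z *m C) x = hessian h x *m C.
Proof.
move=> h2; apply/row_matrixP => i.
have d1 j : differentiable ('D_(delta_mx ord0 j) h) x by exact: (h2.2 _).1.
rewrite rowE -deriveEjacobian mulmx_gradient; last exact: differentiable_lincomb.
rewrite derive_lincomb// row_mul mulmx_sum_row.
by apply: eq_bigr => j _; rewrite !mxE.
Qed.

(** The local defining map is [r] independent combinations of the partial
    derivatives of [h]; its Jacobian at [x0] is [H C]. *)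
Lemma PL_embedded_submanifold (R : realType) n r (h : 'rV[R]_n -> R) mu :
  Ck 2 setT h -> 0 < mu -> (r <= n)%N ->
  (forall x0, argmin setT h x0 -> exists N,
    [/\ open N, N x0, Ck 4 N h & forall z, N z ->
     h z - h x0 <= (2 * mu)^-1 * enorm (gradient h z) ^+ 2]) ->
  (forall x0, argmin setT h x0 -> \rank (hessian h x0) = r) ->
  embedded_submanifold 2 (n - r) (argmin setT h).
Proof.
move=> h2 mu0 rn PL rk; split=> [|x0 Sx0]; first exact: leq_subr.
have rE : (n - (n - r))%N = r by rewrite subKn.
have : \rank (hessian h x0) = (n - (n - r))%N by rewrite rE rk.
move=> /rank_factor[C [D [HCD rHC]]].
have [N [oN Nx0 N4 PLN]] := PL _ Sx0.
have x0min y : h x0 <= h y by exact: Sx0.2.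
have /open_enormP/(_ _ Nx0)[d0 d00 d0N] := oN.
have [|d d_gt0 dP] := PL_zeros h2 mu0 x0min d00 _ HCD.
  by move=> z /d0N; exact: PLN.
exists [set z : 'rV[R]_n | enorm (z - x0) < Num.min d d0].
exists (fun z : 'rV[R]_n => gradient h z *m C).
split.
- exact: open_eball.
- by rewrite /= subrr enorm0 lt_min d_gt0.
- rewrite mulmx_gradient; apply: C2_lincomb => [|i|i]; first exact: open_eball.
    exact: h2.2.
  apply: Ck_le; apply: (@Ck_subset _ _ _ _ N); last exact: N4.2.
  by move=> z /=; rewrite lt_min => /andP[_ /d0N].
- move=> z /=; rewrite lt_min => /andP[/dP <- _]; split=> [[_ zmin]|hz].
    by apply/eqP; rewrite eq_le x0min andbT; exact: zmin.
  by split=> // y _; rewrite hz.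
- by rewrite jacobian_mulmx_gradient.
Qed.

(** * Stability of the rank, and locally constant functions *)

(** If the rank of [B] were larger, a nonzero [v] in the kernel of [A] would
    be orthogonal to the kernel of [B]; there [B] expands by [k], but [v B =
    v (B - A)]. *)
Lemma gap_rank_le (R : realType) n (A B : 'M[R]_n) k :
  (forall v, (forall u, u *m B = 0 -> dot v u = 0) ->
    k * enorm v <= enorm (v *m B)) ->
  (forall v, v != 0 -> enorm (v *m (B - A)) < k * enorm v) ->
  (\rank B <= \rank A)%N.
Proof.
move=> gapB AB; rewrite leqNgt; apply/negP => rAB.
pose O := kermx (kermx B)^T.
have rO : \rank O = \rank B.
  by rewrite mxrank_ker mxrank_tr mxrank_ker subKn// rank_leq_row.
have : (kermx A :&: O)%MS != 0.
  rewrite -mxrank_eq0 -lt0n; have := mxrank_sum_cap (kermx A) O.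
  have := rank_leq_row (kermx A + O)%MS; have := rank_leq_row A.
  by rewrite rO mxrank_ker; lia.
case/rowV0Pn => v; rewrite sub_capmx => /andP[/sub_kermxP vA /sub_kermxP vO] v0.
have : k * enorm v <= enorm (v *m B).
  apply: gapB => u /sub_kermxP/submxP[w ->].
  by rewrite dotE trmx_mul mulmxA vO mul0mx mxE.
by rewrite leNgt => /negP; apply; have := AB v v0; rewrite mulmxBr vA subr0.
Qed.

Lemma gap_rank_eq (R : realType) n (A B : 'M[R]_n) k :
  (forall v, (forall u, u *m A = 0 -> dot v u = 0) ->
    k * enorm v <= enorm (v *m A)) ->
  (forall v, (forall u, u *m B = 0 -> dot v u = 0) ->
    k * enorm v <= enorm (v *m B)) ->
  (forall v, v != 0 -> enorm (v *m (B - A)) < k * enorm v) ->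
  \rank A = \rank B.
Proof.
move=> gA gB AB; apply/eqP; rewrite eqn_leq (gap_rank_le gB AB) andbT.
apply: (gap_rank_le gA) => v v0.
by rewrite -opprB mulmxN enormN AB.
Qed.

Lemma mulmx_enorm_entries (R : realType) n (A : 'M[R]_n) e : 0 <= e ->
  (forall i j, `|A i j| <= e) ->
  forall v : 'rV[R]_n, enorm (v *m A) <= n%:R * n%:R * e * enorm v.
Proof.
move=> e0 Ae v; rewrite (le_trans (enorm_le_sum _))//.
have b j : `|(v *m A) ord0 j| <= n%:R * e * enorm v.
  rewrite mxE (le_trans (ler_norm_sum _ _ _))//.
  apply: (@le_trans _ _ (\sum_(i < n) e * enorm v)).
    by apply: ler_sum => i _; rewrite normrM mulrC ler_pM// ler_coord_enorm.
  by rewrite sumr_const card_ord -[X in X <= _]mulr_natl mulrA.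
rewrite (le_trans (ler_sum _ (fun j _ => b j)))//.
by rewrite sumr_const card_ord -[X in X <= _]mulr_natl !mulrA.
Qed.

(** The points of [A] where [f] takes the value [f x] form a relatively open
    set, and so do the others. *)
Lemma locally_constant_connected (T : topologicalType) (I : Type) (A : set T)
    (f : T -> I) : connected A ->
  (forall x, A x -> \forall y \near x, A y -> f y = f x) ->
  forall x y, A x -> A y -> f x = f y.
Proof.
move=> cA fA x y Ax Ay.
have AO : A `&` [set y | f y = f x] = A `&` [set w | nbhs w [set y | A y -> f y = f x]].
  apply/seteqP; split=> z [Az]; last by move=> /nbhs_singleton/(_ Az).
  by move=> /= <-; split=> //; exact: fA.
have AO' : A `&` [set y | f y = f x] =
    A `&` ~` [set w | nbhs w [set y | A y -> f y <> f x]].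
  apply/seteqP; split=> z [Az]; first by move=> /= fz; split=> // /nbhs_singleton/(_ Az).
  move=> /= nz; split=> //; apply: contrapT => fz; apply: nz.
  by apply: filterS (fA z Az) => w /[apply] ->.
have oN P : open [set w : T | nbhs w P].
  by rewrite openE => z /= zP; rewrite /interior; apply: nbhs_interior.
suff E : A `&` [set y | f y = f x] = A by have : A y by []; rewrite -E => -[_ ->].
apply: cA.
- by exists x.
- by exists [set w | nbhs w [set y | A y -> f y = f x]].
- by exists (~` [set w | nbhs w [set y | A y -> f y <> f x]]) => //; rewrite closedC.
Qed.

(** * Compactness of the sublevel sets, and segments *)

(** The gradient grows at infinity, so [h] does too: from a far point of a
    sublevel set, Ekeland's principle with slope 1 reaches, within a bounded
    distance, a point whose gradient has norm at most 1, and such points are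
    bounded. *)
Lemma sublevel_compact (R : realType) n (h : 'rV[R]_n -> R) m D C' nu :
  Ck 1 setT h -> (forall x, m <= h x) -> 0 < nu ->
  (forall x, D <= enorm x -> nu * (enorm x - C') <= enorm (gradient h x)) ->
  forall c, compact [set x | h x <= c].
Proof.
move=> h1 mh nu0 hD c.
have hc : continuous h by move=> x; exact/differentiable_continuous/h1.1.
apply: (@closed_bounded_compact _ _ _ (`|D| + `|C'| + nu^-1 + (c - m + 1))).
  by apply: (@closed_comp _ _ h [set t | t <= c]) => [x _|]; [exact: hc|exact: closed_le].
move=> x /= xc; have := mh x => mx.
have r0 : 0 < c - m + 1 by lra.
have [|y [yx _ yP]] := ekeland_ball (x := x) hc ltr01 r0 mh; first lra.
have slope : enorm (gradient h y) <= 1.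
  apply: (@gradient_le_slope _ _ _ _ _ (c - m + 1 - enorm (y - x))) => //.
    lra.
  by move=> z zy; apply: yP; have := enorm_triangle y z x; lra.
have yb : enorm y <= `|D| + `|C'| + nu^-1.
  have nuV : 0 < nu^-1 by rewrite invr_gt0.
  have [yD|/ltW/hD yD] := leP (enorm y) D.
    by have := ler_norm D; have := normr_ge0 C'; lra.
  have : enorm y - C' <= nu^-1 * 1 by rewrite ler_pdivlMl//; lra.
  by have := ler_norm C'; have := normr_ge0 D; lra.
have := enormD (x - y) y; rewrite subrK enormB; lra.
Qed.

Lemma seg_continuous (R : realType) n (a b : 'rV[R]_n) :
  continuous (fun t : R => a + t *: (b - a)).
Proof.
move=> t; apply: (@continuousD R 'rV[R]_n R (cst a) (fun t => t *: (b - a))).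
  exact: cst_continuous.
by apply: continuousZr_tmp; exact: cvg_id.
Qed.

Lemma seg_connected (R : realType) n (a b : 'rV[R]_n) : connected (seg a b).
Proof.
apply: connected_continuous_connected; first exact: segment_connected.
exact/continuous_subspaceT/seg_continuous.
Qed.

Lemma seg_compact (R : realType) n (a b : 'rV[R]_n) : compact (seg a b).
Proof.
apply: continuous_compact; last exact: segment_compact.
exact/continuous_subspaceT/seg_continuous.
Qed.

Lemma segl (R : realType) n (a b : 'rV[R]_n) : seg a b a.
Proof. by exists 0; rewrite /= ?in_itv/= ?lexx ?ler01// scale0r addr0. Qed.

Lemma segr (R : realType) n (a b : 'rV[R]_n) : seg a b b.
Proof. by exists 1; rewrite /= ?in_itv/= ?lexx ?ler01// scale1r subrKC. Qed.

Lemma segxx (R : realType) n (a x : 'rV[R]_n) : seg a a x -> x = a.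
Proof. by case=> t _ <-; rewrite subrr scaler0 addr0. Qed.

Lemma seg_sym (R : realType) n (a b : 'rV[R]_n) : seg a b `<=` seg b a.
Proof.
move=> _ [t /= t01 <-]; move: t01; rewrite in_itv/= => /andP[t0 t1].
exists (1 - t).
  by rewrite /= in_itv/=; apply/andP; split; lra.
by apply/rowP => i; rewrite !mxE; ring.
Qed.

(** * Sublevel sets near a point that is not a local minimum *)

(** Three segments suffice to go around a local maximum or below a regular
    point. *)
Definition linked (R : realType) n (W : set 'rV[R]_n) (x y : 'rV[R]_n) :=
  exists r s, [/\ seg x r `<=` W, seg r s `<=` W & seg s y `<=` W].

(** Descend from both points against the gradient, far enough to enter a
    small ball centred at [p - s g] on which [h < h p]; that ball is convex. *)
Lemma linked_regular (R : realType) n (h : 'rV[R]_n -> R) p :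
  Ck 1 setT h -> gradient h p != 0 ->
  \forall x \near p & y \near p, h x < h p -> h y < h p ->
    linked [set z | h z < h p] x y.
Proof.
move=> h1 g0; set g := gradient h p in g0.
have G0 : 0 < enorm g by rewrite enorm_gt0.
set G := enorm g in G0; have e0 : 0 < G / 4 by rewrite divr_gt0.
have [d d0 dP] := strict_diff p h1 e0.
have [s s0 sG] : exists2 s, 0 < s & s * G = d / 4.
  by exists (d / 4 / G); [rewrite !divr_gt0|rewrite divfK// gt_eqF].
have desc x y : enorm (x - p) < d -> enorm (y - p) < d ->
    h y <= h x + dot (y - x) g + G / 4 * enorm (y - x).
  by move=> xd yd; have := dP x y xd yd; rewrite ler_norml => /andP[_]; lra.
have pp : enorm (p - p) < d by rewrite subrr enorm0.
(* the descent has length d / 4; on the ball of radius d / 16 around its end the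
   gain d / 4 * G dominates the errors d / 16 * G and G / 4 * (d / 16 + d / 4) *)
pose U := [set x : 'rV[R]_n | enorm (x - p) < d / 16].
have down q : U q -> h q < h p -> seg q (q - s *: g) `<=` [set z | h z < h p].
  move=> qU qp _ [t /= t01 <-]; have {}qU : enorm (q - p) < d / 16 by exact: qU.
  move: t01; rewrite in_itv/= => /andP[t0 t1].
  have -> : q + t *: (q - s *: g - q) = q - (t * s) *: g.
    by apply/rowP => i; rewrite !mxE; ring.
  set y := q - (t * s) *: g.
  have yq : y - q = - (t * s) *: g by rewrite /y addrC addKr scaleNr.
  have yqn : enorm (y - q) = t * (d / 4).
    have ts0 : 0 <= t * s by exact: (mulr_ge0 t0 (ltW s0)).
    by rewrite yq enormZ normrN (ger0_norm ts0) -sG mulrA.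
  have td : t * (d / 4) <= d / 4 by rewrite ler_piMl// ltW// divr_gt0.
  have yd : enorm (y - p) < d by have := enorm_triangle q y p; lra.
  have := desc q y _ yd; rewrite yqn yq dotZl -enorm_sqr -/G => /(_ _)/wrap[|].
    lra.
  have -> : - (t * s) * G ^+ 2 = - (t * (d / 4)) * G by rewrite -sG; ring.
  have : 0 <= t * (d / 4) * G by rewrite !mulr_ge0// ltW// divr_gt0.
  lra.
have low z : enorm (z - (p - s *: g)) < d / 16 -> h z < h p.
  set u := z - (p - s *: g) => ud.
  have zp : z - p = u + - s *: g by apply/rowP => i; rewrite !mxE; ring.
  have zpn : enorm (z - p) <= d / 16 + d / 4.
    rewrite zp (le_trans (enormD _ _))// enormZ normrN gtr0_norm// -/G sG; lra.
  have := desc p z pp _; rewrite zp dotDl dotZl -enorm_sqr -zp -/G => /(_ _)/wrap[|].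
    lra.
  have := le_trans (ler_norm _) (dot_le_enorm u g); rewrite -/G.
  have -> : - s * G ^+ 2 = - (d / 4) * G by rewrite -sG; ring.
  have : enorm u * G < d / 16 * G by rewrite ltr_pM2r.
  have : 0 < d * G by rewrite mulr_gt0.
  have : G / 4 * enorm (z - p) <= G / 4 * (d / 16 + d / 4) by rewrite ler_pM2l.
  lra.
have nU : nbhs p U by apply: nbhs_enorm; rewrite divr_gt0.
exists (U, U) => // -[x y] /= [Ux Uy] xp yp.
exists (x - s *: g), (y - s *: g); split; first exact: down.
- have sh w : w - s *: g - (p - s *: g) = w - p.
    by apply/rowP => i; rewrite !mxE; ring.
  by move=> z zs; apply/low/(seg_ball _ _ zs); rewrite sh.
- by move=> z /seg_sym; exact: down.
Qed.

Lemma continuous_sum_fun (R : realType) (V : normedModType R) n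
    (F : 'I_n -> V -> R) x :
  (forall i, {for x, continuous (F i)}) ->
  {for x, continuous (fun z => \sum_(i < n) F i z)}.
Proof.
move=> cF; rewrite (_ : (fun _ => _) = (fun z => \sum_(i < n) F i z *: (1 : R^o))).
  exact: continuous_lincomb.
by apply/funext => z; apply: eq_bigr => i _; rewrite /GRing.scale/= mulr1.
Qed.

(** By homogeneity, from the compactness of the unit sphere. *)
Lemma negative_definite_bound (R : realType) n (A : 'M[R]_n) :
  negative_definite A -> exists2 l, 0 < l &
    forall v, dot v (v *m A) <= - l * enorm v ^+ 2.
Proof.
move=> nA; pose q (v : 'rV[R]_n) := - dot v (v *m A).
have cq : continuous q.
  move=> v; rewrite /q /dot; apply: continuousN.
  apply: continuous_sum_fun => i; apply: continuousM; first exact: coord_continuous.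
  rewrite (_ : (fun _ => _) = (fun w : 'rV[R]_n => \sum_(j < n) w ord0 j * A j i)).
    apply: continuous_sum_fun => j; apply: continuousM; last exact: cst_continuous.
    exact: coord_continuous.
  by apply/funext => w; rewrite mxE.
have q_gt0 v : v != 0 -> 0 < q v.
  by move=> v0; rewrite oppr_gt0 dotC dotE; exact: nA.
have scale v : v != 0 -> q v = enorm v ^+ 2 * q ((enorm v)^-1 *: v).
  move=> v0; rewrite /q -scalemxAl dotZl dotZr.
  by field; rewrite enorm_eq0.
pose K := [set v : 'rV[R]_n | enorm v = 1].
have [K0|/set0P/negP/negPn/eqP K0] := pselect (K !=set0); last first.
  exists 1 => // v; have [->|v0] := eqVneq v 0.
    by rewrite enorm0 expr0n mulr0 -[X in dot X](scale0r 0) dotZl mul0r.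
  have : K ((enorm v)^-1 *: v).
    by rewrite /K/= enormZ normfV ger0_norm ?enorm_ge0// mulVf// enorm_eq0.
  by rewrite K0.
have cK : compact K.
  apply: (@closed_bounded_compact _ _ _ 1) => [|v ->//].
  rewrite (_ : K = (fun v => enorm (v - 0)) @^-1` [set t | t = 1]); last first.
    by apply/funext => v; rewrite /K/= subr0.
  by apply: closed_comp => [v _|]; [exact: continuous_enorm|exact: closed_eq].
have [v0 v0K v0P] := compact_min K0 cK cq.
have v0n : v0 != 0 by rewrite -enorm_gt0 v0K.
exists (q v0) => [|v]; first exact: q_gt0.
have [->|vn] := eqVneq v 0.
  by rewrite enorm0 expr0n mulr0 -[X in dot X](scale0r 0) dotZl mul0r.
have := scale v vn; have := v0P ((enorm v)^-1 *: v).
rewrite /K /= enormZ normfV ger0_norm ?enorm_ge0// mulVf ?enorm_eq0// => /(_ erefl) h1.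
have : 0 < enorm v ^+ 2 by rewrite exprn_gt0// enorm_gt0.
rewrite {1}/q; nra.
Qed.

(** By the mean value theorem the increment is [<v, gradient (p + t v)>] with
    [v = x - p], which is [t <v, v H>] up to a small multiple of [t |v|^2]. *)
Lemma strict_local_max (R : realType) n (h : 'rV[R]_n -> R) p :
  Ck 2 setT h -> gradient h p = 0 -> negative_definite (hessian h p) ->
  exists2 d, 0 < d & forall x, enorm (x - p) < d -> x != p -> h x < h p.
Proof.
move=> h2 g0 /negative_definite_bound[l l0 lP].
have l20 : 0 < l / 2 by rewrite divr_gt0.
have [d d0 dP] := gradient_strict_diff p h2 l20.
exists d => // x xd xp; have v0 : 0 < enorm (x - p) by rewrite enorm_gt0 subr_eq0.
have [t /andP[t0 t1]] := @MVT_line _ _ h p (x - p) (fun y => h2.1 y I).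
rewrite subrKC; set v := x - p in v0 *; set y := p + t *: v => hx.
have yp : y - p = t *: v by rewrite /y addrC addKr.
have ypn : enorm (y - p) = t * enorm v by rewrite yp enormZ gtr0_norm.
have pp : enorm (p - p) < d by rewrite subrr enorm0.
have := dP p y pp; rewrite ypn g0 subr0 yp -scalemxAl => /(_ _)/wrap[|yP].
  by rewrite -/v in xd; nra.
have := le_trans (ler_norm _) (dot_le_enorm v (gradient h y - t *: (v *m hessian h p))).
rewrite dotBr dotZr => b.
have b2 : enorm v * enorm (gradient h y - t *: (v *m hessian h p)) <=
   enorm v * (l / 2 * (t * enorm v)) by rewrite ler_pM2l.
have b3 : t * dot v (v *m hessian h p) <= t * (- l * enorm v ^+ 2) by rewrite ler_pM2l.
have b4 : 0 < t * l * enorm v ^+ 2 by rewrite !mulr_gt0// exprn_gt0.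
rewrite -subr_lt0 hx; lra.
Qed.

Lemma orth_vector (R : realType) n (u : 'rV[R]_n) : (2 <= n)%N ->
  exists2 v : 'rV[R]_n, v != 0 & dot u v = 0.
Proof.
move=> n2; have : kermx u^T != 0.
  rewrite -mxrank_eq0 mxrank_ker mxrank_tr -lt0n subn_gt0.
  by rewrite (leq_ltn_trans (rank_leq_row _)).
by case/rowV0Pn => v /sub_kermxP vu v0; exists v => //; rewrite dotC dotE vu mxE.
Qed.

(** Points of the segment that lie on the line through [p] and [q] reduce to
    [q], since the segment leaves that line orthogonally to [q - p]. *)
Lemma seg_avoid (R : realType) n (p q v : 'rV[R]_n) :
  v != 0 -> q != p -> dot (q - p) v = 0 -> ~ seg q (p + v) p.
Proof.
move=> v0 qp qv [t _ tp].
have e : (1 - t) *: (q - p) + t *: v = 0.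
  by apply/rowP => i; move/rowP/(_ i) : tp; rewrite !mxE; lra.
have : dot ((1 - t) *: (q - p) + t *: v) v = 0 by rewrite e -(scale0r 0) dotZl mul0r.
rewrite dotDl !dotZl qv mulr0 add0r => /eqP; rewrite mulf_eq0 => /orP[/eqP t0|].
  by move: tp; rewrite t0 scale0r addr0; apply/eqP.
by rewrite -enorm_sqr sqrf_eq0 enorm_eq0 (negPf v0).
Qed.

(** In dimension at least 2 a punctured ball is connected: if [p] lies on the
    segment from [x] to [y], go through a point displaced from [p]
    orthogonally. *)
Lemma linked_max (R : realType) n (h : 'rV[R]_n -> R) p d : (2 <= n)%N ->
  0 < d -> (forall x, enorm (x - p) < d -> x != p -> h x < h p) ->
  forall x y, enorm (x - p) < d -> enorm (y - p) < d -> h x < h p -> h y < h p ->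
    linked [set z | h z < h p] x y.
Proof.
move=> n2 d0 dP x y xd yd xp yp.
have xNp : x != p by apply/eqP => xE; rewrite xE ltxx in xp.
have yNp : y != p by apply/eqP => yE; rewrite yE ltxx in yp.
have segW a b : enorm (a - p) < d -> enorm (b - p) < d -> ~ seg a b p ->
    seg a b `<=` [set z | h z < h p].
  move=> ad bd abp z zs; apply: dP; first exact: seg_ball zs.
  by apply/eqP => zp; rewrite zp in zs.
have pt a : h a < h p -> seg a a `<=` [set z | h z < h p] by move=> ap z /segxx ->.
have [[t _ tp]|xyp] := pselect (seg x y p); last first.
  by exists x, x; split; [exact: pt|exact: pt|exact: segW].
have [v v0 xv] := orth_vector (x - p) n2.
have vn : 0 < enorm v by rewrite enorm_gt0.
pose s := d / 2 / enorm v; have s0 : 0 < s by rewrite !divr_gt0.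
have rd : enorm (p + s *: v - p) < d.
  by rewrite [p + _]addrC addrK enormZ gtr0_norm// divfK ?gt_eqF//; lra.
have sv0 : s *: v != 0 by rewrite scaler_eq0 negb_or (gt_eqF s0).
have e : t *: (y - p) = - (1 - t) *: (x - p).
  by apply/rowP => i; move/rowP/(_ i) : tp; rewrite !mxE; lra.
have t0 : t != 0.
  by apply/eqP => t0; move: tp xNp; rewrite t0 scale0r addr0 => ->; rewrite eqxx.
have yv : dot (y - p) v = 0.
  have : dot (t *: (y - p)) v = 0 by rewrite e dotZl xv mulr0.
  by rewrite dotZl => /eqP; rewrite mulf_eq0 (negPf t0) => /eqP.
have xr : ~ seg x (p + s *: v) p by apply: seg_avoid => //; rewrite dotZr xv mulr0.
have yr : ~ seg y (p + s *: v) p by apply: seg_avoid => //; rewrite dotZr yv mulr0.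
exists (p + s *: v), (p + s *: v); split; first exact: segW.
  apply/pt/dP => //; rewrite -subr_eq0 [p + _]addrC addrK//.
by move=> z /seg_sym; exact: segW.
Qed.

(** Excludes saddle points. *)
Definition critical_dichotomy (R : realType) n (h : 'rV[R]_n -> R) :=
  forall x, gradient h x = 0 ->
    local_minima h x \/ negative_definite (hessian h x).

Lemma not_local_min_lt (R : realType) n (h : 'rV[R]_n -> R) p (N : set 'rV[R]_n) :
  ~ local_minima h p -> nbhs p N -> exists2 y, N y & h y < h p.
Proof.
move=> pmin pN; apply: contrapT => /forall2NP noy; apply: pmin.
by apply: filterS pN => y yN; case: (noy y) => // /negP; rewrite -leNgt.
Qed.

(** The link between the points of [U] below level [h p] is what fails at a
    saddle point, where the lower region near [p] may be disconnected. *)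
Lemma local_linked (R : realType) n (h : 'rV[R]_n -> R) p : (2 <= n)%N ->
  Ck 2 setT h -> critical_dichotomy h -> ~ local_minima h p ->
  exists U, [/\ open U, U p,
    forall x y, U x -> U y -> h x < h p -> h y < h p ->
      linked [set z | h z < h p] x y &
    forall y, U y -> h y = h p -> ~ local_minima h y].
Proof.
move=> n2 h2 hcrit pmin; have h1 := Ck_le h2.
have [g0|g0] := eqVneq (gradient h p) 0.
  have [//|nH] := hcrit p g0.
  have [d d0 dP] := strict_local_max h2 g0 nH.
  exists [set x | enorm (x - p) < d]; split=> [||x y xd yd|y yd hy].
  - exact: open_eball.
  - by rewrite /= subrr enorm0.
  - exact: (@linked_max _ _ h p d).
  - have [->//|yp] := eqVneq y p.
    by have := dP y yd yp; rewrite hy ltxx.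
have [[U1 U2] /= [/nbhs_enormP[d1 d10 dU1] /nbhs_enormP[d2 d20 dU2]] UP] :=
  linked_regular h1 g0.
have [|d3 d30 dP3] := @gradient_continuous _ _ h p h1 (enorm (gradient h p)).
  by rewrite enorm_gt0.
pose d := Num.min d1 (Num.min d2 d3).
exists [set x | enorm (x - p) < d]; split=> [||x y|y].
- exact: open_eball.
- by rewrite /= subrr enorm0 !lt_min d10 d20.
- rewrite /= !lt_min => /and3P[xd _ _] /and3P[_ yd _].
  by apply: (UP (x, y)); split; [exact: dU1|exact: dU2].
- rewrite /= !lt_min => /and3P[_ _ /dP3 yd] _ /(local_min_gradient h1) y0.
  by move: yd; rewrite y0 sub0r enormN ltxx.
Qed.

(** * Connectedness of the set of minimizers *)

(** The bound [e < c], uniform on [B], makes a connection inside the open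
    sublevel set at level [c] a connection inside some closed sublevel set of
    lower level. *)
Definition reach (R : realType) n (h : 'rV[R]_n -> R) c (a : 'rV[R]_n) :=
  [set x | exists B e, [/\ connected B, B a, B x, e < c & forall z, B z -> h z <= e]].

Section reach.
Variables (R : realType) (n : nat) (h : 'rV[R]_n -> R) (c : R) (a : 'rV[R]_n).
Hypothesis hc : continuous h.

Lemma reach_lt x : reach h c a x -> h x < c.
Proof. by case=> B [e [_ _ Bx ec BP]]; exact: le_lt_trans (BP _ Bx) ec. Qed.

(** The maximum of [h] on the compact segment gives the new uniform bound. *)
Lemma reach_seg x y : reach h c a x -> seg x y `<=` [set z | h z < c] ->
  reach h c a y.
Proof.
move=> [B [e [cB Ba Bx ec BP]]] xyc.
have [] := @compact_min _ _ (fun z => - h z) (seg x y).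
- by exists x; exact: segl.
- exact: seg_compact.
- by move=> z; apply: continuousN; exact: hc.
move=> w ws wP; exists (B `|` seg x y), (Num.max e (h w)); split.
- by apply: connectedU => //; [exists x; split => //; exact: segl|exact: seg_connected].
- by left.
- by right; exact: segr.
- by rewrite gt_max ec; exact: xyc.
- by move=> z [/BP ze|/wP]; rewrite le_max ?ze// lerN2 => ->; rewrite orbT.
Qed.

Lemma reach_linked x y : reach h c a x -> linked [set z | h z < c] x y ->
  reach h c a y.
Proof.
by move=> ax [r [s [/(reach_seg ax) ar /(reach_seg ar) ras /(reach_seg ras)]]].
Qed.

Lemma reach_near x : h x < c -> closure (reach h c a) x ->
  \forall y \near x, reach h c a y.
Proof.
move=> xc ax.
have /nbhs_enormP[d d0 dP] : nbhs x [set y | h y < c].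
  have /continuous_enormP/(_ (c - h x)) := hc (x := x).
  case=> [|d d0 dP]; first by rewrite subr_gt0.
  apply/nbhs_enormP; exists d => // y /dP; rewrite ltr_norml => /andP[_].
  by rewrite /= ltrD2r.
apply/nbhs_enormP; exists d => // y yd; have [z [az zd]] := ax _ (nbhs_enorm x d0).
by apply: (reach_seg az) => w ws; apply: dP; exact: seg_ball ws.
Qed.

End reach.

Definition separates (R : realType) n (A P Q : set 'rV[R]_n) a b :=
  [/\ closed P, closed Q, P `&` Q = set0, A = P `|` Q & P a /\ Q b].

(** A separation cuts any connected subset containing both points. *)
Lemma connected_not_separates (R : realType) n (A P Q B : set 'rV[R]_n) a b :
  separates A P Q a b -> connected B -> B `<=` A -> B a -> B b -> False.
Proof.
move=> [cP cQ PQ0 E [Pa Qb]] cB BA Ba Bb.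
have NPQ x : P x -> Q x -> False by move=> Px Qx; rewrite -[False]/(set0 x) -PQ0.
suff BP : B `&` P = B by have : B b by []; rewrite -BP => -[_ /NPQ]; exact.
apply: cB.
- by exists a.
- exists (~` Q); first exact: closed_openC.
  apply/seteqP; split=> x [Bx]; first by move=> Px; split=> // /(NPQ x Px).
  by move=> nQx; split=> //; move/BA : Bx; rewrite E => -[].
- by exists P.
Qed.

Section mountain_pass.
Variables (R : realType) (n : nat) (h : 'rV[R]_n -> R) (a b : 'rV[R]_n).
Hypothesis n2 : (2 <= n)%N.
Hypothesis h2 : Ck 2 setT h.
Hypothesis hcrit : critical_dichotomy h.
Hypothesis hcomp : forall c, compact [set x | h x <= c].
Hypothesis hab : h a = h b.

Let hc : continuous h.
Proof. by move=> x; exact/differentiable_continuous/h2.1. Qed.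

Let sep c := exists P Q, separates [set x | h x <= c] P Q a b.

Let closed_sub c : closed [set x | h x <= c].
Proof. by apply: (@closed_comp _ _ h [set t | t <= c]) => [x _|]; [exact: hc|exact: closed_le]. Qed.

Lemma sep_le c c' : sep c -> h a <= c' -> c' <= c -> sep c'.
Proof.
move=> [P [Q [cP cQ PQ0 E [Pa Qb]]]] ac' c'c.
exists (P `&` [set x | h x <= c']), (Q `&` [set x | h x <= c']); split.
- exact: closedI.
- exact: closedI.
- by rewrite setIACA PQ0 set0I.
- by rewrite -setIUl -E; apply/seteqP; split=> [x /= xc'|x []//]; split=> //=; exact: le_trans c'c.
- by split; split => //=; rewrite -?hab.
Qed.

(** Put [P] and [Q] into disjoint open sets [U] and [V]. Outside [U] and [V]
    the function stays above [c] by compactness, so these sets still separate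
    the sublevel sets of slightly higher level. *)
Lemma sep_lt c : sep c -> exists2 c', c < c' & sep c'.
Proof.
move=> [P [Q [cP cQ PQ0 E [Pa Qb]]]].
have [U [V [oU oV PU QV UV0]]] := (@normal_openP R _).1 pseudometric_normal P Q cP cQ PQ0.
have [c' cc' c'P] : exists2 c', c < c' & [set x | h x <= c'] `<=` U `|` V.
  pose K := [set x | h x <= c + 1] `&` ~` (U `|` V).
  have cK : compact K.
    apply: (subclosed_compact _ (@hcomp (c + 1))); last by move=> x [].
    by apply: closedI => //; apply: open_closedC; exact: openU.
  have [K0|/set0P/negP/negPn/eqP K0] := pselect (K !=set0); last first.
    exists (c + 1); first by lra.
    move=> x xc; apply: contrapT => xUV.
    by have : K x by []; rewrite K0.
  have [w [wc wUV] wP] := compact_min K0 cK hc.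
  have cw : c < h w.
    rewrite ltNge; apply/negP => wc'; apply: wUV.
    by have : [set x | h x <= c] w by []; rewrite E => -[/PU|/QV]; [left|right].
  exists (Num.min (c + 1) ((c + h w) / 2)); first by rewrite lt_min; lra.
  move=> x /=; rewrite le_min => /andP[xc xw]; apply: contrapT => xUV.
  by have : h w <= h x by [apply: wP]; lra.
exists c' => //; exists ([set x | h x <= c'] `&` ~` V), ([set x | h x <= c'] `&` ~` U).
have ac : h a <= c by have : (P `|` Q) a by [left]; rewrite -E.
have UVE x : U x -> V x -> False by move=> Ux Vx; rewrite -[False]/(set0 x) -UV0.
split.
- by apply: closedI => //; exact: open_closedC.
- by apply: closedI => //; exact: open_closedC.
- by apply/seteqP; split=> // x [[xc xV] [_ xU]]; case: (c'P x xc).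
- apply/seteqP; split=> x; last by case=> -[].
  move=> xc; case: (c'P x xc) => [xU|xV]; [left|right]; split=> // ?; exact: (UVE x).
- split; split=> /=.
  + by lra.
  + by move=> Va; apply: (UVE a) => //; exact: PU.
  + by rewrite -hab; lra.
  + by move=> Ub; apply: (UVE b) => //; exact: QV.
Qed.

(** This is where saddle points are excluded. The points reachable from [a]
    below level [c] have a closure [P] that is relatively open in the closed
    sublevel set: a point [p] of [P] at level [c] is no local minimum, and
    near it everything below level [c] is linked, hence reachable. If [b]
    were in [P] it would be reachable, which contradicts a separation at a
    lower level. *)
Lemma sep_lim c : h a < c -> (forall c', h a <= c' -> c' < c -> sep c') -> sep c.
Proof.
move=> ac sc; pose W := reach h c a; pose P := closure W.
pose L := [set x | h x <= c].
have WL : W `<=` L by move=> x /reach_lt/ltW.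
have PL : P `<=` L by move=> x /(closureS WL)/closed_sub.
pose O : set 'rV[R]_n := [set x | nbhs x [set y | L y -> P y]].
have oO : open O by rewrite openE => x /=; exact: nbhs_interior.
have Wa : W a.
  exists [set a], (h a); split=> //; first exact: connected1.
  by move=> _ ->.
have PO : P `<=` O.
  move=> p Pp; have := PL p Pp; rewrite /L /= le_eqVlt => /orP[/eqP pc|pc]; last first.
    by apply: filterS (reach_near hc pc Pp) => y Wy _; exact: subset_closure.
  have pmin : ~ local_minima h p.
    move=> /Pp[y [Wy /=]]; rewrite leNgt pc => /negP; apply; exact: reach_lt Wy.
  have [U [oU Up]] := local_linked n2 h2 hcrit pmin.
  rewrite pc => Ulink Umin.
  have UW y : U y -> h y < c -> W y.
    move=> Uy yc; have [q [Wq Uq]] := Pp _ (open_nbhs_nbhs (conj oU Up)).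
    apply: (reach_linked hc Wq); apply: Ulink => //; exact: reach_lt Wq.
  apply: filterS (open_nbhs_nbhs (conj oU Up)) => y Uy.
  rewrite /L /= le_eqVlt => /orP[/eqP yc|/(UW _ Uy)]; last exact: subset_closure.
  move=> N Ny; have NU : nbhs y (N `&` U).
    by apply: filterI => //; exact: open_nbhs_nbhs.
  have [z [Nz Uz] zy] := not_local_min_lt (Umin y Uy yc) NU.
  by exists z; split=> //; apply: UW => //; rewrite -yc.
(* P is the intersection of L with the open set O, so L minus P is closed *)
exists P, (L `&` ~` O); split.
- exact: closed_closure.
- by apply: closedI; [exact: closed_sub|exact: open_closedC].
- by apply/seteqP; split=> // x [/PO Ox [_]].
- apply/seteqP; split=> x; last by move=> [/PL|[]].
  move=> Lx; have [Ox|nOx] := pselect (O x); [left|by right].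
  exact: (nbhs_singleton Ox).
- split; first exact: subset_closure.
  split; first by rewrite /L/= -hab ltW.
  move=> Ob; have Lb : L b by rewrite /L/= -hab ltW.
  have Pb : P b := nbhs_singleton Ob Lb.
  have bc : h b < c by rewrite -hab.
  have [B [e [cB Ba Bb ec BP]]] := nbhs_singleton (reach_near hc bc Pb).
  have [P' [Q' sPQ]] := sc e (BP _ Ba) ec.
  exact: (connected_not_separates sPQ cB).
Qed.

(** The segment from [a] to [b] lies in some sublevel set. *)
Lemma not_sep : exists2 c, h a <= c & ~ sep c.
Proof.
have [] := @compact_min _ _ (fun z => - h z) (seg a b).
- by exists a; exact: segl.
- exact: seg_compact.
- by move=> z; apply: continuousN; exact: hc.
move=> w ws wP; exists (h w).
  by have := wP a (segl a b); rewrite lerN2.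
move=> [P [Q sPQ]]; apply: (connected_not_separates sPQ (@seg_connected _ _ a b)).
- by move=> z /wP; rewrite lerN2.
- exact: segl.
- exact: segr.
Qed.

(** Separation holds at the supremum of the separating levels and then
    slightly above it, although it fails at some level. *)
Lemma mountain_pass : ~ sep (h a).
Proof.
move=> sa; pose E := [set c | h a <= c /\ sep c].
have [c1 ac1 nc1] := not_sep.
have E0 : E !=set0 by exists (h a).
have Eub : ubound E c1.
  by move=> c [ac sc]; rewrite leNgt; apply/negP => /ltW cc1; apply: nc1; exact: sep_le cc1.
have supE : has_sup E by split => //; exists c1.
have asup : h a <= sup E by apply: sup_upper_bound.
have ssup : sep (sup E).
  move: asup; rewrite le_eqVlt => /orP[/eqP <-//|asup].
  apply: sep_lim => // c' ac' c'sup.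
  have [c [ac sc] c'c] := sup_gt E0 c'sup.
  exact: sep_le (ltW c'c).
have [c' supc' sc'] := sep_lt ssup.
have : c' <= sup E by apply: sup_upper_bound => //; split => //; rewrite (le_trans asup)// ltW.
by rewrite leNgt supc'.
Qed.

End mountain_pass.

(** A mountain pass between two pieces of the set of minimizers would be a
    critical point that is neither a local minimum nor a strict local
    maximum. *)
Lemma argmin_connected (R : realType) n (h : 'rV[R]_n -> R) : (2 <= n)%N ->
  Ck 2 setT h -> critical_dichotomy h ->
  (forall c, compact [set x | h x <= c]) ->
  connected (argmin setT h).
Proof.
move=> n2 h2 hcrit hcomp B [a Ba] [V oV BV] [C cC BC].
have hc : continuous h by move=> x; exact/differentiable_continuous/h2.1.
have BS : B `<=` argmin setT h by rewrite BV => x [].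
rewrite eqEsubset; split => // b Sb; apply: contrapT => nBb.
have Sa := BS _ Ba; have hab : h a = h b.
  by apply/eqP; rewrite eq_le (proj2 Sa)// (proj2 Sb).
have SE : argmin setT h = [set x | h x <= h a].
  apply/seteqP; split=> x /=; first by move=> [_]; exact.
  by move=> xa; split=> // y _; rewrite (le_trans xa)//; exact: (proj2 Sa).
have cS : closed (argmin setT h).
  by rewrite SE; apply: (@closed_comp _ _ h [set t | t <= h a]) => [x _|];
    [exact: hc|exact: closed_le].
apply: (mountain_pass n2 h2 hcrit hcomp hab).
exists B, (argmin setT h `&` ~` V); split.
- by rewrite BC; exact: closedI.
- by apply: closedI => //; exact: open_closedC.
- by apply/seteqP; split=> // x [+ [_]]; rewrite BV => -[].
- rewrite -SE; apply/seteqP; split=> x; last by case=> [/BS|[]].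
  by move=> Sx; have [Vx|nVx] := pselect (V x); [left; rewrite BV|right].
- by split=> //; split=> // Vb; apply: nBb; rewrite BV.
Qed.

(** * Consequences of the hypotheses on one function *)

Lemma PLcirc_near_argmin (R : realType) d mu (h : 'rV[R]_d -> R) x0 :
  PLcirc mu h -> argmin setT h x0 -> exists N,
    [/\ open N, N x0, Ck 4 N h & forall z, N z ->
     h z - h x0 <= (2 * mu)^-1 * enorm (gradient h z) ^+ 2].
Proof.
move=> [_ [[N [PL N4 _]] _]] [_ x0min].
pose M := connected_component (local_minima h) x0.
have Mx0 : local_minima h x0 by apply: filterS filterT => z _; exact: x0min.
have cM : components (local_minima h) M by exists x0.
have [oN MN [x1 [_ x1min] PLx1]] := PL M cM.
have Nx0 : N M x0 by apply: MN; exact: connected_component_refl.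
exists (N M); split=> //; first exact: N4.
move=> z Nz; have := PLx1 z Nz; have := x1min _ Nx0; have := x0min x1 I; lra.
Qed.

Lemma PLcirc_critical (R : realType) d mu (h : 'rV[R]_d -> R) :
  PLcirc mu h -> critical_dichotomy h.
Proof.
move=> [h2 [[N [PL _ Nout]] _]] x gx.
have [[M cM NMx]|xout] := pselect ((\bigcup_(M in components (local_minima h)) N M) x).
  left; have [oN _ [x1 [_ x1min] /(_ _ NMx)]] := PL M cM.
  rewrite gx enorm0 expr0n mulr0 subr_le0 => xx1.
  apply: filterS (open_nbhs_nbhs (conj oN NMx)) => y Ny.
  exact: le_trans (x1min _ Ny).
by right; exact: Nout.
Qed.

Lemma argmin_bounded (R : realType) d mu (h : 'rV[R]_d -> R) :
  PLcirc mu h -> exists2 M, 0 < M & forall x, argmin setT h x -> enorm x <= M.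
Proof.
move=> [_ [_ [K cK MK]]]; have [M M0 KM] := compact_enorm_bounded cK.
exists M => // x [_ xmin]; apply/KM/MK.
by apply: filterS filterT => z _; exact: xmin.
Qed.

Lemma dist_ge (R : realType) n (x : 'rV[R]_n) (A : set 'rV[R]_n) M :
  (forall y, A y -> enorm y <= M) -> ((enorm x - M)%:E <= dist x A)%E.
Proof.
move=> AM; apply: le_ereal_inf_tmp => _ [y Ay <-]; rewrite lee_fin.
by have := enormD (x - y) y; rewrite subrK; have := AM y Ay; lra.
Qed.

Lemma error_bound_real (R : realType) n (x : 'rV[R]_n) (A : set 'rV[R]_n) M nu s :
  0 < nu -> (forall y, A y -> enorm y <= M) ->
  (nu%:E * dist x A <= s%:E)%E -> nu * (enorm x - M) <= s.
Proof.
move=> nu0 AM; rewrite -lee_fin EFinM; apply: le_trans.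
by rewrite lee_pmul2l// ?lte_fin// dist_ge.
Qed.

(** The distance to the empty set is infinite. *)
Lemma dist_finite_nonempty (R : realType) n (x : 'rV[R]_n) (A : set 'rV[R]_n) nu s :
  0 < nu -> (nu%:E * dist x A <= s%:E)%E -> A !=set0.
Proof.
move=> nu0; have [//|/set0P/negP/negPn/eqP ->] := pselect (A !=set0).
by rewrite /dist image_set0 ereal_inf0 gt0_muley ?lte_fin// leye_eq.
Qed.

Lemma enorm_large (R : realType) n D : (0 < n)%N -> 0 < D ->
  exists x : 'rV[R]_n, D <= enorm x.
Proof.
move=> n0 D0; exists (D *: delta_mx ord0 (Ordinal n0)).
by rewrite enormZ enorm_delta mulr1 gtr0_norm.
Qed.

(** * Variation of the parameter *)

Lemma enorm_row_mx (R : realType) m n (a : 'rV[R]_m) (b : 'rV[R]_n) :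
  enorm (row_mx a b) <= enorm a + enorm b.
Proof.
rewrite -(@ler_pXn2r _ 2)// ?nnegrE ?addr_ge0 ?enorm_ge0//.
rewrite sqrrD !enorm_sqr {1}/dot big_split_ord/=.
under eq_bigr do rewrite row_mxEl.
under [X in _ + X]eq_bigr do rewrite row_mxEr.
have : 0 <= enorm a * enorm b by rewrite mulr_ge0 ?enorm_ge0.
rewrite -/(dot a a) -/(dot b b); lra.
Qed.

Lemma row_mx_near (R : realType) m n (t t' : 'rV[R]_m) (x x' : 'rV[R]_n) d :
  enorm (t' - t) < d / 2 -> enorm (x' - x) < d / 2 ->
  enorm (row_mx t' x' - row_mx t x) < d.
Proof.
move=> td xd; rewrite opp_row_mx add_row_mx.
by have := enorm_row_mx (t' - t) (x' - x); lra.
Qed.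

Lemma convex_seg (R : realType) n (A : set 'rV[R]_n) a b :
  convex_set A -> A a -> A b -> seg a b `<=` A.
Proof.
move=> cA Aa Ab _ [t /= + <-]; rewrite in_itv/= => /andP[t0 t1].
have : t *: b + (1 - t) *: a \in A.
  by apply: (cA b a (Itv01 t0 t1)); rewrite inE.
rewrite inE; congr A.
by apply/rowP => i; rewrite !mxE; ring.
Qed.

Lemma PLcirc_hessian_gap (R : realType) d mu (h : 'rV[R]_d -> R) x0 v :
  0 < mu -> PLcirc mu h -> argmin setT h x0 ->
  (forall u, u *m hessian h x0 = 0 -> dot v u = 0) ->
  mu / 2 * enorm v <= enorm (v *m hessian h x0).
Proof.
move=> mu0 PL Sx0; have [N [oN Nx0 _ PLN]] := PLcirc_near_argmin PL Sx0.
have /open_enormP/(_ _ Nx0)[e e0 eN] := oN.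
apply: (@PL_hessian_gap _ _ _ _ _ e) => //; first exact: PL.1.
- by move=> y; exact: Sx0.2.
- by move=> z /eN; exact: PLN.
Qed.

(** Continuity on the cylinder, in terms of entries and of the two variables. *)
Lemma hessian_near (R : realType) m d (Theta : set 'rV[R]_m)
    (g : 'rV[R]_m -> 'rV[R]_d -> R) t x :
  {within @cylinder R m d Theta,
    continuous (fun z : 'rV[R]_(m + d) => hessian (g (lsubmx z)) (rsubmx z))} ->
  Theta t -> forall e, 0 < e -> exists2 r, 0 < r & forall t' x', Theta t' ->
    enorm (t' - t) < r -> enorm (x' - x) < r ->
    forall i j, `|(hessian (g t') x' - hessian (g t) x) i j| <= e.
Proof.
move=> /subspace_continuousP cH Tt e e0.
have cyl t' (x' : 'rV_d) : Theta t' -> @cylinder R m d Theta (row_mx t' x').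
  by rewrite /cylinder /= row_mxKl.
have := cH _ (cyl t x Tt) => /cvgrPdist_lt/(_ _ e0).
rewrite near_withinE => /nbhs_enormP[r r0 rP].
exists (r / 2) => [|t' x' Tt' tr xr i j]; first by rewrite divr_gt0.
have := rP _ (row_mx_near tr xr) (cyl _ x' Tt').
rewrite /from_subspace !row_mxKl !row_mxKr distrC => /ltW; apply: le_trans.
by rewrite [leRHS]/Num.norm/= mx_normrE; apply/bigmax_geP; right; exists (i, j).
Qed.

Section family.
Variables (R : realType) (m d : nat) (Theta : set 'rV[R]_m).
Variables (f g : 'rV[R]_m -> 'rV[R]_d -> R) (mu : R).
Hypothesis d2 : (2 <= d)%N.
Hypothesis mu0 : 0 < mu.
Hypothesis PL : forall t, Theta t -> PLcirc mu (g t).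
Hypothesis hreg : regularity Theta f g.

Let rk t x := \rank (hessian (g t) x).

(** Both Hessians expand by [mu / 2] on the orthogonal of their kernels,
    while they differ by at most [mu / 4] in operator norm. *)
Lemma rank_near t x : Theta t -> sol g t x ->
  exists2 r, 0 < r & forall t' x', Theta t' -> sol g t' x' ->
    enorm (t' - t) < r -> enorm (x' - x) < r -> rk t' x' = rk t x.
Proof.
move=> Tt Sx.
have d0 : 0 < d%:R * d%:R :> R by rewrite mulr_gt0// ltr0n; lia.
pose e := mu / 4 / (d%:R * d%:R); have e0 : 0 < e by rewrite !divr_gt0.
have [r r0 rP] := hessian_near x (reg_g_hess_cont hreg) Tt e0.
exists r; first exact: r0.
move=> t' x' Tt' Sx' tr xr; apply: (@gap_rank_eq _ _ _ _ (mu / 2)) => [v|v|v v0].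
- exact: PLcirc_hessian_gap (PL Tt') Sx'.
- exact: PLcirc_hessian_gap (PL Tt) Sx.
have ent i j : `|(hessian (g t) x - hessian (g t') x') i j| <= e.
  by rewrite -opprB mxE normrN; exact: rP.
rewrite (le_lt_trans (mulmx_enorm_entries (ltW e0) ent v))//.
have -> : d%:R * d%:R * e = mu / 4 by rewrite /e mulrC divfK// gt_eqF.
by rewrite ltr_pM2r ?enorm_gt0//; have := mu0; lra.
Qed.

Lemma sol_nonempty t : Theta t -> sol g t !=set0.
Proof.
move=> Tt; have [Deb [nu [Deb0 nu0 eb]]] := reg_g_eb hreg.
have [x xD] := @enorm_large R d Deb (ltnW d2) Deb0.
exact: dist_finite_nonempty nu0 (eb _ _ Tt xD).
Qed.

Lemma sol_connected t : Theta t -> connected (sol g t).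
Proof.
move=> Tt; have h2 : Ck 2 setT (g t) := (PL Tt).1.
apply: argmin_connected => //; first exact: PLcirc_critical (PL Tt).
have [x0 Sx0] := sol_nonempty Tt.
have [Deb [nu [Deb0 nu0 eb]]] := reg_g_eb hreg.
have [M M0 SM] := argmin_bounded (PL Tt).
apply: (@sublevel_compact _ _ _ (g t x0) Deb M nu) => //; first exact: Ck_le.
  by move=> x; exact: Sx0.2.
move=> x xD; exact: error_bound_real nu0 SM (eb _ _ Tt xD).
Qed.

Lemma rank_sol t x y : Theta t -> sol g t x -> sol g t y -> rk t x = rk t y.
Proof.
move=> Tt; apply: locally_constant_connected; first exact: sol_connected.
move=> {}x Sx; have [r r0 rP] := rank_near Tt Sx.
apply/nbhs_enormP; exists r; first exact: r0.
by move=> {}y yr Sy; apply: rP; rewrite ?subrr ?enorm0.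
Qed.

(** At a minimizer [x] for [t'] the gradient for [t'] vanishes, so the
    gradient for [t] is small; the error bound at infinity for [t] then keeps
    [x] near the bounded set of minimizers for [t]. *)
Lemma sol_near_bounded t : Theta t ->
  exists M, forall t' x, Theta t' -> enorm (t' - t) < 1 -> sol g t' x -> enorm x <= M.
Proof.
move=> Tt; have [Deb [nu [Deb0 nu0 eb]]] := reg_g_eb hreg.
have [M M0 SM] := argmin_bounded (PL Tt).
have [Ltx Lip] := reg_g_lip_t hreg.
exists (Deb + M + `|Ltx| / nu) => t' x Tt' tt' Sx.
have L0 : 0 <= `|Ltx| / nu by rewrite divr_ge0// ltW.
have [xD|/ltW xD] := leP (enorm x) Deb; first lra.
have := error_bound_real nu0 SM (eb _ _ Tt xD).
have h1 : Ck 1 setT (g t') := Ck_le (PL Tt').1.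
have := Lip t t' x Tt Tt'.
rewrite (argmin_gradient h1) ?subr0; last by move=> y; exact: Sx.2.
rewrite enormB => Lx xM.
have : enorm x - M <= `|Ltx| / nu.
  rewrite ler_pdivlMr// mulrC (le_trans xM)// (le_trans Lx)//.
  have := ler_norm Ltx; have := enorm_ge0 (t' - t); have := normr_ge0 Ltx; nra.
lra.
Qed.

(** The graph of the solution map is closed, since the objective is jointly
    continuous. *)
Lemma not_sol_near t x : Theta t -> ~ sol g t x ->
  exists2 r, 0 < r & forall t' x', Theta t' ->
    enorm (t' - t) < r -> enorm (x' - x) < r -> ~ sol g t' x'.
Proof.
move=> Tt nSx; have [y yx] : exists y, g t y < g t x.
  apply: contrapT => ny; apply: nSx; split=> // y _.
  by rewrite leNgt; apply/negP => yx; apply: ny; exists y.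
have [G [[[U [oU cU U2]] Gg] _]] := reg_g_C2 hreg.
have Gc z e : 0 < e -> exists2 r, 0 < r & forall t' z', Theta t' ->
    enorm (t' - t) < r -> enorm (z' - z) < r -> `|g t' z' - g t z| < e.
  move=> e0; have Uz : U (row_mx t z) by apply: cU; rewrite /cylinder/= row_mxKl.
  have : {for row_mx t z, continuous G} by exact/differentiable_continuous/U2.1.
  move/continuous_enormP/(_ _ e0) => [r r0 rP].
  exists (r / 2) => [|t' z' Tt' tr zr]; first by rewrite divr_gt0.
  by have := rP _ (row_mx_near tr zr); rewrite !Gg.
have e0 : 0 < (g t x - g t y) / 2 by rewrite divr_gt0// subr_gt0.
have [r1 r10 r1P] := Gc x _ e0; have [r2 r20 r2P] := Gc y _ e0.
exists (Num.min r1 r2); first by rewrite lt_min r10.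
move=> t' x' Tt'; rewrite !lt_min => /andP[t1 t2] /andP[x1 _] [_ /(_ y I)].
have := r1P _ _ Tt' t1 x1.
have := r2P t' y Tt' t2; rewrite subrr enorm0 => /(_ r20).
rewrite !ltr_norml => /andP[_ a1] /andP[a2 _]; lra.
Qed.

(** Every point [z] of a compact ball that contains the nearby solution sets
    has a neighbourhood in which solutions have the right rank: by
    [rank_near] if [z] is a solution for [t], and vacuously otherwise.
    Compactness makes the neighbourhood of [t] uniform. *)
Lemma rank_param_near t x : Theta t -> sol g t x ->
  \forall t' \near t, Theta t' -> forall x', sol g t' x' -> rk t' x' = rk t x.
Proof.
move=> Tt Sx; have [M MP] := sol_near_bounded Tt.
pose P (t' : 'rV[R]_m) (x' : 'rV[R]_d) :=
  Theta t' -> sol g t' x' -> rk t' x' = rk t x.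
have local z : [set x' : 'rV[R]_d | enorm (x' - 0) <= M] z ->
    \forall x' \near z & t' \near t, P t' x'.
  move=> _; suff [r r0 rP] : exists2 r, 0 < r & forall t' z',
      enorm (t' - t) < r -> enorm (z' - z) < r -> P t' z'.
    exists ([set z' | enorm (z' - z) < r], [set t' | enorm (t' - t) < r]).
      by split; exact: nbhs_enorm.
    by move=> [z' t'] [/= z'r t'r]; exact: rP.
  have [Sz|nSz] := pselect (sol g t z).
    have [r r0 rP] := rank_near Tt Sz; exists r; first exact: r0.
    move=> t' z' t'r z'r Tt' Sz'.
    exact (etrans (rP t' z' Tt' Sz' t'r z'r) (rank_sol Tt Sz Sx)).
  have [r r0 rP] := not_sol_near Tt nSz; exists r; first exact: r0.
  by move=> t' z' t'r z'r Tt' Sz'; case: (rP _ _ Tt' t'r z'r Sz').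
have cov := proj1 (compact_near_coveringP _) (@compact_eball R d 0 M)
  _ (nbhs t) P (nbhs_filter t) local.
apply: filterS2 cov (nbhs_enorm t ltr01) => t' Pt' t'1 Tt' x' Sx'.
have x'M : [set z : 'rV[R]_d | enorm (z - 0) <= M] x'.
  by rewrite /= subr0; exact: MP Sx'.
exact: Pt' x'M Tt' Sx'.
Qed.

End family.

Theorem lemma3p6 (R : realType) (m d : nat) (Theta : set 'rV[R]_m)
    (f g : 'rV[R]_m -> 'rV[R]_d -> R)
    (hm : (1 <= m)%N) (hd : (2 <= d)%N)
    (hTheta0 : Theta !=set0) (hThetac : compact Theta)
    (hThetav : convex_set Theta)
    (hPL : uniform_PLcirc Theta g)
    (hreg : regularity Theta f g) :
  exists k : nat, forall t, Theta t -> embedded_submanifold 2 k (sol g t).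
Proof.
have [mu mu0 PL] := hPL; have [t0 Tt0] := hTheta0.
have [x0 Sx0] := sol_nonempty hd hreg Tt0.
exists (d - \rank (hessian (g t0) x0))%N => t Tt.
apply: (@PL_embedded_submanifold _ _ _ _ mu (PL t Tt).1 mu0).
- exact: rank_leq_row.
- by move=> x Sx; exact: PLcirc_near_argmin (PL t Tt) Sx.
move=> x Sx.
have /choice[p pS] s : exists y, Theta s -> sol g s y.
  have [Ts|nTs] := pselect (Theta s); last by exists 0.
  by have [y Sy] := sol_nonempty hd hreg Ts; exists y.
have seg_near s : seg t0 t s -> \forall s' \near s, seg t0 t s' ->
    \rank (hessian (g s') (p s')) = \rank (hessian (g s) (p s)).
  move=> /(convex_seg hThetav Tt0 Tt) Ts.
  have := rank_param_near hd mu0 PL hreg Ts (pS s Ts).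
  apply: filterS => s' s'P /(convex_seg hThetav Tt0 Tt) Ts'.
  exact: s'P Ts' _ (pS _ Ts').
have pt := locally_constant_connected (@seg_connected _ _ t0 t) seg_near
  (segr t0 t) (segl t0 t).
have xp := rank_sol hd mu0 PL hreg Tt Sx (pS _ Tt).
have px := rank_sol hd mu0 PL hreg Tt0 (pS _ Tt0) Sx0.
exact (etrans xp (etrans pt px)).
Qed.
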